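(* Let $W_\alpha$ be a weighted shift with moment sequence $\gamma=(\gamma_n)_{n=0}^\infty$, and let $\delta_n:=\ln\left(\frac{\gamma_n\gamma_{n+2}}{\gamma_{n+1}^2}\right)$ for $n\ge 0$. The following statements are equivalent. (i) $W_\alpha$ is $\mathcal{MID}$. (ii) The sequence $(\delta_n)_{n=0}^\infty$ is a Stieltjes moment sequence. (iii) The weighted shift with moments $\left(\frac{\delta_n}{\delta_0}\right)_{n=0}^\infty$ is subnormal.
   Context: Weighted shifts: given a bounded sequence $\alpha=(\alpha_n)_{n=0}^\infty$ of positive real numbers, $W_\alpha$ is the bounded operator on $\ell^2(\mathbb{N}_0)$ with $W_\alpha e_n=\alpha_n e_{n+1}$. Its moments are $\gamma_0:=1$, $\gamma_n:=\prod_{j=0}^{n-1}\alpha_j^2$ for $n\ge 1$. For $p>0$, the Schur power $W_\alpha^p$ denotes the weighted shift with weights $(\alpha_n^p)_{n\ge0}$. An operator is subnormal if it is the restriction of a normal operator to a closed invariant subspace. $W_\alpha$ is moment infinitely divisible ($\mathcal{MID}$) if the Schur power $W_\alpha^p$ is subnormal for every $p>0$. A real sequence $(\delta_n)$ is a Stieltjes moment sequence if both infinite Hankel matrices $(\delta_{i+j})_{i,j=0}^\infty$ and $(\delta_{i+j+1})_{i,j=0}^\infty$ are positive semi-definite (all finite principal submatrices positive semi-definite); equivalently, $\delta_n=\int t^n\,d\mu(t)$ ($n\ge0$) for some positive Borel measure $\mu$ on $[0,\infty)$.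
   Formalization: Statement (iii) is read as: either all δ_n = 0, or δ_0 > 0 and the weighted shift with moments δ_n/δ_0 (zero weights allowed) is subnormal; as worded, (iii) is undefined if δ_0 = 0 and the equivalence fails for δ_n = -2^{-n}. *)

(* Defs.v *)
From HB Require Import structures.
From mathcomp Require Import all_boot all_order all_algebra.
From mathcomp Require Import sesquilinear complex ring lra.
From mathcomp Require Import all_classical all_reals.
From mathcomp Require Import interval_inference topology normedtype sequences exp.

Set Implicit Arguments.
Unset Strict Implicit.
Unset Printing Implicit Defensive.

Import Order.TTheory GRing.Theory Num.Theory.
Import numFieldNormedType.Exports.

Local Open Scope classical_set_scope.
Local Open Scope ring_scope.

Local Notation Re := (@complex.Re _).
Local Notation Im := (@complex.Im _).

Structure hilbertType (R : realType) := HilbertType {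
  hilbert_sort :> completeNormedModType R[i];
  inner : {dot hilbert_sort for (@Num.conj R[i])};
  hilbert_normE : forall u, `|u| ^+ 2 = inner u u
}.
Arguments inner {R h}.

Section Operators.
Context {R : realType}.
Implicit Types H K : hilbertType R.

Definition bounded_op H K (T : {linear H -> K}) : Prop :=
  exists M : R, forall u, `|T u| <= M%:C%C * `|u|.

Definition is_adjoint H K (T : H -> K) (S : K -> H) : Prop :=
  forall u v, inner (T u) v = inner u (S v).

(* The adjoint of a bounded operator exists and is unique, so the existential
   quantifier below merely names it. *)
Definition normal_op H (N : {linear H -> H}) : Prop :=
  bounded_op N /\
  exists S : H -> H, is_adjoint N S /\ forall u, N (S u) = S (N u).

(* K contains H through the linear isometry V, whose range is closed since H
   is complete; the last clause says that this range is invariant under N and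
   that N restricts to T on it. *)
Definition subnormal H (T : {linear H -> H}) : Prop :=
  exists (K : hilbertType R) (N : {linear K -> K}) (V : {linear H -> K}),
  [/\ normal_op N,
      forall u v, inner (V u) (V v) = inner u v
    & forall u, V (T u) = N (V u)].
End Operators.

Section PreHilbert.
Context {C : numClosedFieldType} {V : lmodType C}.
Variable f : {dot V for (@Num.conj C)}.

Lemma dot_CauchySchwarz u v : `|f u v| ^+ 2 <= f u u * f v v.
Proof.
have [->|v0] := eqVneq v 0; first by rewrite !linear0r normr0 expr0n mulr0.
have fv : 0 < f v v by rewrite dnorm_gt0.
rewrite -(ler_pM2l fv) -subr_ge0.
have := dnorm_ge0 f (f v v *: u - f u v *: v).
rewrite dnormB !dnormZ linearZl_LR linearZr_LR/= !rmorphM/= conjCK.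
have -> : `|f v v| = f v v by rewrite ger0_norm// ltW.
have -> : (f v v)^* = f v v by apply/CrealP/ger0_real; rewrite ltW.
rewrite normCK; set a := f u u; set b := f v v; set x := f u v; set y := x^*.
by congr (0 <= _); ring.
Qed.

Lemma dot_normD u v :
  sqrtC (f (u + v) (u + v)) <= sqrtC (f u u) + sqrtC (f v v).
Proof.
have fge0 w : 0 <= f w w by exact: dnorm_ge0.
have sge0 w : 0 <= sqrtC (f w w) by rewrite sqrtC_ge0.
rewrite -ler_sqr ?nnegrE ?addr_ge0//.
rewrite sqrrD !sqrtCK dnormD [leRHS]addrAC lerD2l.
have -> : f u v + (f u v)^* = ('Re (f u v)) *+ 2.
  by rewrite ReE -[_ *+ 2]mulr_natr divfK// pnatr_eq0.
rewrite lerMn2r/=; apply: le_trans (_ : `|f u v| <= _).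
  by have /= [] := leif_Re_Creal (f u v).
by rewrite -ler_sqr ?nnegrE ?mulr_ge0// exprMn !sqrtCK dot_CauchySchwarz.
Qed.

Lemma dot_normZ a u : sqrtC (f (a *: u) (a *: u)) = `|a| * sqrtC (f u u).
Proof.
rewrite dnormZ rootCMl ?exprn_ge0//; congr (_ * _).
by rewrite sqrCK.
Qed.

Lemma dot_norm_eq0 u : sqrtC (f u u) = 0 -> u = 0.
Proof. by move/eqP; rewrite sqrtC_eq0 dnorm_eq0 => /eqP. Qed.
End PreHilbert.

Section EllTwo.
Context {R : realType}.
Implicit Types (z w : R[i]) (x y : nat -> R[i]).

Definition sqnormc z : R := Re z ^+ 2 + Im z ^+ 2.

Lemma sqnormcE z : `|z| ^+ 2 = (sqnormc z)%:C%C.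
Proof. by rewrite -add_Re2_Im2. Qed.

Lemma sqnormc_ge0 z : 0 <= sqnormc z.
Proof. by rewrite addr_ge0// sqr_ge0. Qed.
Hint Resolve sqnormc_ge0 : core.

Lemma sqnormc_eq0 z : (sqnormc z == 0) = (z == 0).
Proof. by rewrite paddr_eq0 ?sqr_ge0// !sqrf_eq0 eq_complex. Qed.

Lemma sqnormcM z w : sqnormc (z * w) = sqnormc z * sqnormc w.
Proof. by case: z w => [a b] [c d]; rewrite /sqnormc/=; ring. Qed.

Lemma sqnormcD z w : sqnormc (z + w) <= 2 * sqnormc z + 2 * sqnormc w.
Proof.
rewrite /sqnormc !raddfD/= -subr_ge0.
have -> : 2 * (Re z ^+ 2 + Im z ^+ 2) + 2 * (Re w ^+ 2 + Im w ^+ 2) -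
  ((Re z + Re w) ^+ 2 + (Im z + Im w) ^+ 2) =
  (Re z - Re w) ^+ 2 + (Im z - Im w) ^+ 2 by ring.
by rewrite addr_ge0// sqr_ge0.
Qed.

Definition ell2 : {pred nat -> R[i]} :=
  fun x => `[< cvgn (series (fun n => sqnormc (x n))) >].

Lemma ell2P x :
  reflect (cvgn (series (fun n => sqnormc (x n)))) (x \in ell2).
Proof. exact: asboolP. Qed.

Lemma ell2_submod_closed : submod_closed ell2.
Proof.
split=> [|a x y /ell2P xl /ell2P yl]; apply/ell2P.
  rewrite (_ : series _ = fun=> 0); first exact: is_cvg_cst.
  by apply/funext => n; rewrite /series/= big1// => i _; rewrite /sqnormc/= !expr0n addr0.
apply: (@series_le_cvg _ _ ((2 * sqnormc a) *: (fun n => sqnormc (x n))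
   + (2 : R) *: (fun n => sqnormc (y n)))) => //.
- by move=> n; rewrite addr_ge0// mulr_ge0// mulr_ge0.
- by move=> n; apply: le_trans (sqnormcD _ _) _; rewrite sqnormcM mulrA.
- by apply: is_cvg_seriesD; apply: is_cvg_seriesZ.
Qed.
HB.instance Definition _ := GRing.isSubmodClosed.Build R[i] (nat -> R[i]) ell2
  ell2_submod_closed.
End EllTwo.
#[global] Hint Resolve sqnormc_ge0 : core.
Arguments ell2 : clear implicits.

Record l2 (R : realType) := L2 { l2_val :> nat -> R[i] ; _ : l2_val \in ell2 R }.
HB.instance Definition _ (R : realType) := [isSub for @l2_val R].
HB.instance Definition _ (R : realType) := [Choice of l2 R by <:].
HB.instance Definition _ (R : realType) := [SubChoice_isSubLmodule of l2 R by <:].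

Section EllTwoInner.
Context {R : realType}.
Implicit Types (f g h : l2 R).

Definition l2_inner f g : R[i] :=
  (limn (series (fun n => Re (f n * (g n)^*))) +i*
   limn (series (fun n => Im (f n * (g n)^*))))%C.

Lemma l2_summable f : cvgn (series (fun n => sqnormc (f n))).
Proof. by case: f => x /= /ell2P. Qed.
Arguments l2_summable : clear implicits.

Lemma Re_mulJ (z w : R[i]) : Re (z * w^*) = Re z * Re w + Im z * Im w.
Proof. by case: z w => [a b] [c d] /=; ring. Qed.
Lemma Im_mulJ (z w : R[i]) : Im (z * w^*) = Im z * Re w - Re z * Im w.
Proof. by case: z w => [a b] [c d] /=; ring. Qed.

Lemma normr_Re_mulJ_le (z w : R[i]) :
  `|Re (z * w^*)| <= sqnormc z + sqnormc w.
Proof.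
rewrite Re_mulJ /sqnormc; case: z w => [a b] [c d] /=.
have := (sqr_ge0 (a - c), sqr_ge0 (b - d), sqr_ge0 (a + c), sqr_ge0 (b + d)).
case=> [[[h1 h2] h3] h4]; have := (sqr_ge0 a, sqr_ge0 b, sqr_ge0 c, sqr_ge0 d).
by case=> [[[h5 h6] h7] h8]; rewrite ler_norml; apply/andP; split; nra.
Qed.

Lemma normr_Im_mulJ_le (z w : R[i]) :
  `|Im (z * w^*)| <= sqnormc z + sqnormc w.
Proof.
rewrite Im_mulJ /sqnormc; case: z w => [a b] [c d] /=.
have := (sqr_ge0 (a - d), sqr_ge0 (b - c), sqr_ge0 (a + d), sqr_ge0 (b + c)).
case=> [[[h1 h2] h3] h4]; have := (sqr_ge0 a, sqr_ge0 b, sqr_ge0 c, sqr_ge0 d).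
by case=> [[[h5 h6] h7] h8]; rewrite ler_norml; apply/andP; split; nra.
Qed.

Lemma cvg_l2_Re f g : cvgn (series (fun n => Re (f n * (g n)^*))).
Proof.
apply: normed_cvg.
apply: (@series_le_cvg _ _ (fun n => sqnormc (f n) + sqnormc (g n))) => //.
- by move=> n; exact: normr_ge0.
- by move=> n; rewrite addr_ge0 ?sqnormc_ge0.
- by move=> n; exact: normr_Re_mulJ_le.
- by have := is_cvg_seriesD (l2_summable f) (l2_summable g).
Qed.

Lemma cvg_l2_Im f g : cvgn (series (fun n => Im (f n * (g n)^*))).
Proof.
apply: normed_cvg.
apply: (@series_le_cvg _ _ (fun n => sqnormc (f n) + sqnormc (g n))) => //.
- by move=> n; exact: normr_ge0.
- by move=> n; rewrite addr_ge0 ?sqnormc_ge0.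
- by move=> n; exact: normr_Im_mulJ_le.
- by have := is_cvg_seriesD (l2_summable f) (l2_summable g).
Qed.
Arguments cvg_l2_Re : clear implicits.
Arguments cvg_l2_Im : clear implicits.

Lemma lim_series_lin (a b : R) (u v w : R^nat) :
  cvgn (series u) -> cvgn (series v) -> cvgn (series w) ->
  limn (series (fun n => a * u n + b * v n + w n)) =
  a * limn (series u) + b * limn (series v) + limn (series w).
Proof.
move=> cu cv cw; apply/cvg_lim => //.
rewrite (_ : series _ = fun n => a * series u n + b * series v n + series w n).
  by apply: cvgD => //; apply: cvgD; apply: cvgM => //; exact: cvg_cst.
by apply/funext => n; rewrite /series/= !mulr_sumr -!big_split.
Qed.

Lemma l2_inner_linl g (a : R[i]) f h :
  l2_inner (a *: f + h) g = a * l2_inner f g + l2_inner h g.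
Proof.
rewrite /l2_inner.
have -> : (fun n => Re ((a *: f + h) n * (g n)^*)) = (fun n =>
    Re a * Re (f n * (g n)^*) + (- Im a) * Im (f n * (g n)^*)
    + Re (h n * (g n)^*)).
  apply/funext => n; rewrite /= [LHS](_ : _ = Re ((a * f n + h n) * (g n)^*))//.
  by case: a (f n) (g n) (h n) => [? ?] [? ?] [? ?] [? ?] /=; ring.
have -> : (fun n => Im ((a *: f + h) n * (g n)^*)) = (fun n =>
    Re a * Im (f n * (g n)^*) + Im a * Re (f n * (g n)^*)
    + Im (h n * (g n)^*)).
  apply/funext => n; rewrite /= [LHS](_ : _ = Im ((a * f n + h n) * (g n)^*))//.
  by case: a (f n) (g n) (h n) => [? ?] [? ?] [? ?] [? ?] /=; ring.
rewrite (lim_series_lin _ _ (cvg_l2_Re f g) (cvg_l2_Im f g) (cvg_l2_Re h g)).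
rewrite (lim_series_lin _ _ (cvg_l2_Im f g) (cvg_l2_Re f g) (cvg_l2_Im h g)).
case: a => [a b]; apply/eqP; rewrite eq_complex/=; apply/andP; split; apply/eqP; ring.
Qed.

Lemma l2_inner_herm f g : l2_inner f g = (l2_inner g f)^*.
Proof.
rewrite /l2_inner; apply/eqP; rewrite eq_complex/=; apply/andP; split; apply/eqP.
  by congr (limn (series _)); apply/funext => n; rewrite !Re_mulJ; ring.
rewrite -lim_seriesN; last exact: cvg_l2_Im.
by congr (limn (series _)); apply/funext => n; rewrite /GRing.opp/= !Im_mulJ; ring.
Qed.

Lemma l2_inner_bilinear : bilinear_for
  (GRing.Scale.Law.clone _ _ ( *%R ) _)
  (GRing.Scale.Law.clone _ _ ((@Num.conj R[i]) \; *%R ) _) l2_inner.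
Proof.
split=> [g a f h|f a g h]; first exact: l2_inner_linl.
rewrite l2_inner_herm l2_inner_linl rmorphD rmorphM/=.
by rewrite -!l2_inner_herm.
Qed.

HB.instance Definition _ := bilinear_isBilinear.Build R[i] (l2 R) (l2 R) R[i]
  _ _ l2_inner l2_inner_bilinear.

Lemma l2_inner_sym f g : l2_inner f g = (-1) ^+ false * (l2_inner g f)^*.
Proof. by rewrite mul1r -l2_inner_herm. Qed.

HB.instance Definition _ := isHermitianSesquilinear.Build R[i] (l2 R) false
  (@Num.conj R[i]) l2_inner l2_inner_sym.

Lemma l2_inner_diag f :
  l2_inner f f = (limn (series (fun n => sqnormc (f n))))%:C%C.
Proof.
apply/eqP; rewrite eq_complex/=; apply/andP; split; apply/eqP.
  congr (limn (series _)); apply/funext => n.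
  by rewrite Re_mulJ /sqnormc !expr2.
rewrite (_ : series _ = fun=> 0) ?lim_cst//.
apply/funext => n; rewrite /series/= big1// => i _.
by rewrite Im_mulJ mulrC subrr.
Qed.

Lemma l2_partial_le f n :
  \sum_(0 <= i < n) sqnormc (f i) <= limn (series (fun n => sqnormc (f n))).
Proof.
have := @nondecreasing_cvgn_le _ (series (fun n => sqnormc (f n))).
apply; last exact: l2_summable.
by apply: nondecreasing_series => i _ _; exact: sqnormc_ge0.
Qed.

Lemma l2_inner_gt0 f : f != 0 -> 0 < l2_inner f f.
Proof.
move=> f0; rewrite l2_inner_diag ltcR; have [n fn0] : exists n, f n != 0.
  apply: contrapT => /forallNP fn; move/eqP: f0; apply.
  apply/val_inj/funext => n; have /negP/negPn/eqP := fn n; exact.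
apply: lt_le_trans (l2_partial_le f n.+1).
rewrite big_nat_recr//=; apply: ltr_wpDl.
  by apply: sumr_ge0 => i _; exact: sqnormc_ge0.
by rewrite lt_neqAle sqnormc_ge0 andbT eq_sym sqnormc_eq0.
Qed.

HB.instance Definition _ := isDotProduct.Build R[i] (l2 R) l2_inner l2_inner_gt0.

HB.instance Definition _ := Lmodule_isNormed.Build R[i] (l2 R)
  (@dot_normD _ _ l2_inner) (@dot_normZ _ _ l2_inner)
  (@dot_norm_eq0 _ _ l2_inner).

Lemma l2_normE f : `|f| ^+ 2 = l2_inner f f.
Proof. exact: sqrtCK. Qed.

Definition l2_rnorm f : R := Re `|f|.

Lemma l2_rnormE f : `|f| = (l2_rnorm f)%:C%C.
Proof. by rewrite RRe_real// ger0_real. Qed.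

Lemma l2_rnorm_ge0 f : 0 <= l2_rnorm f.
Proof. by rewrite -ler0c -l2_rnormE normr_ge0. Qed.

Lemma l2_rnorm_sqr f :
  l2_rnorm f ^+ 2 = limn (series (fun n => sqnormc (f n))).
Proof.
by apply: complexI; rewrite rmorphXn/= -l2_rnormE l2_normE l2_inner_diag.
Qed.

Lemma l2_rnormD f g : l2_rnorm (f + g) <= l2_rnorm f + l2_rnorm g.
Proof. by rewrite -lecR rmorphD/= -!l2_rnormE ler_normD. Qed.

Lemma l2_rnormB f g : l2_rnorm (f - g) = l2_rnorm (g - f).
Proof. by rewrite /l2_rnorm distrC. Qed.

Lemma ell2_bounded (x : nat -> R[i]) (M : R) :
  (forall n, \sum_(0 <= k < n) sqnormc (x k) <= M) -> x \in ell2 R.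
Proof.
move=> xM; apply/ell2P; apply: nondecreasing_is_cvgn.
  by apply: nondecreasing_series => i _ _; exact: sqnormc_ge0.
by exists M => _ [n _ <-]; exact: xM.
Qed.

Lemma l2_rnorm_le f (M : R) : 0 <= M ->
  (forall n, \sum_(0 <= k < n) sqnormc (f k) <= M ^+ 2) -> l2_rnorm f <= M.
Proof.
move=> M0 fM; rewrite -(@ler_pXn2r _ 2)// ?nnegrE ?l2_rnorm_ge0// l2_rnorm_sqr.
by apply: limr_le; [exact: l2_summable|near=> n; exact: fM].
Unshelve. all: by end_near. Qed.

Lemma l2_partial_rnorm f n :
  \sum_(0 <= k < n) sqnormc (f k) <= l2_rnorm f ^+ 2.
Proof. by rewrite l2_rnorm_sqr l2_partial_le. Qed.

Lemma l2_coord_le f n : sqnormc (f n) <= l2_rnorm f ^+ 2.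
Proof.
apply: le_trans (l2_partial_rnorm f n.+1).
rewrite big_nat_recr//= lerDr; apply: sumr_ge0 => i _; exact: sqnormc_ge0.
Qed.

Lemma l2_Re_le f n : `|Re (f n)| <= l2_rnorm f.
Proof.
rewrite -(@ler_pXn2r _ 2)// ?nnegrE ?l2_rnorm_ge0//.
apply: le_trans (l2_coord_le f n).
by rewrite real_normK ?num_real// lerDl sqr_ge0.
Qed.

Lemma l2_Im_le f n : `|Im (f n)| <= l2_rnorm f.
Proof.
rewrite -(@ler_pXn2r _ 2)// ?nnegrE ?l2_rnorm_ge0//.
apply: le_trans (l2_coord_le f n).
by rewrite real_normK ?num_real// lerDr sqr_ge0.
Qed.

Lemma R_cauchy_seq (v : R^nat) :
  (forall e : R, 0 < e -> exists N, forall m n, (N <= m)%N -> (N <= n)%N ->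
    `|v m - v n| <= e) -> cvgn v.
Proof.
move=> vc; apply/cauchy_cvgP/cauchy_exP => e e0.
have [|N vN] := vc (e / 2); first by rewrite divr_gt0.
exists (v N); exists N => // n Nn.
rewrite /ball/=; apply: le_lt_trans (vN _ _ (leqnn N) Nn) _.
by rewrite ltr_pdivrMr// ltr_pMr// ltr1n.
Qed.

Lemma l2_seq_complete (u : nat -> l2 R) :
  (forall e : R, 0 < e -> exists N, forall m n, (N <= m)%N -> (N <= n)%N ->
    l2_rnorm (u m - u n) <= e) ->
  exists l, forall e : R, 0 < e -> exists N, forall n, (N <= n)%N ->
    l2_rnorm (u n - l) <= e.
Proof.
move=> uc.
have cRe k : cvgn (fun n => Re (u n k)).
  apply: R_cauchy_seq => e /uc[N uN]; exists N => m n Nm Nn.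
  by apply: le_trans (uN _ _ Nm Nn); rewrite -raddfB; exact: (l2_Re_le (u m - u n)).
have cIm k : cvgn (fun n => Im (u n k)).
  apply: R_cauchy_seq => e /uc[N uN]; exists N => m n Nm Nn.
  by apply: le_trans (uN _ _ Nm Nn); rewrite -raddfB; exact: (l2_Im_le (u m - u n)).
pose y k : R[i] := (limn (fun n => Re (u n k)) +i* limn (fun n => Im (u n k)))%C.
have key e : 0 < e -> exists N, forall n, (N <= n)%N ->
    forall K, \sum_(0 <= k < K) sqnormc (u n k - y k) <= e ^+ 2.
  move=> e0; have [N uN] := uc e e0; exists N => n Nn K.
  have cv : (fun m => \sum_(0 <= k < K) sqnormc (u n k - u m k)) @ \oo -->
      \sum_(0 <= k < K) sqnormc (u n k - y k).
    elim: K => [|K IH]; first by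
      under eq_fun do rewrite big_nil; rewrite big_nil; exact: cvg_cst.
    under eq_fun do rewrite big_nat_recr//=.
    rewrite big_nat_recr//=; apply: cvgD => //; rewrite /sqnormc.
    have -> : (fun m => Re (u n K - u m K) ^+ 2 + Im (u n K - u m K) ^+ 2) =
      (fun m => (Re (u n K) - Re (u m K)) * (Re (u n K) - Re (u m K))
         + (Im (u n K) - Im (u m K)) * (Im (u n K) - Im (u m K))).
      by apply/funext => m; rewrite !raddfB !expr2.
    rewrite !raddfB !expr2/=.
    have cR : (fun m => Re (u n K) - Re (u m K)) @ \oo --> Re (u n K) - Re (y K).
      by apply: cvgB; [exact: cvg_cst|exact: cRe].
    have cI : (fun m => Im (u n K) - Im (u m K)) @ \oo --> Im (u n K) - Im (y K).
      by apply: cvgB; [exact: cvg_cst|exact: cIm].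
    by apply: cvgD; [exact: (cvgM cR cR)|exact: (cvgM cI cI)].
  rewrite -(cvg_lim _ cv)//; apply: limr_le; first by apply/cvg_ex; eexists; exact: cv.
  exists N => // m /= Nm; apply: le_trans (l2_partial_rnorm (u n - u m) K) _.
  by rewrite (@ler_pXn2r _ 2)// ?nnegrE ?l2_rnorm_ge0 ?(ltW e0)// uN.
have [N0 uN0] := key 1 ltr01.
have yl : y \in ell2 R.
  have dl : (fun k => u N0 k - y k) \in ell2 R by apply: ell2_bounded; exact: uN0.
  have -> : y = (u N0 : nat -> R[i]) - (fun k => u N0 k - y k).
    by apply/funext => k; rewrite -[RHS]/(u N0 k - (u N0 k - y k)) subKr.
  by apply: rpredB => //; case: (u N0).
exists (L2 yl) => e e0; have [N uN] := key e e0; exists N => n Nn.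
by apply: l2_rnorm_le; [exact: ltW|move=> K; exact: (uN n Nn K)].
Qed.

Lemma l2_ball f g (e : R) : ball f e%:C%C g = (l2_rnorm (f - g) < e) :> Prop.
Proof. by rewrite -ball_normE/= l2_rnormE ltcR. Qed.

Lemma l2_complete (F : set_system (l2 R)) :
  ProperFilter F -> cauchy F -> cvg F.
Proof.
move=> FF /cauchyP Fc.
have d0 k : 0 < k.+1%:R^-1 :> R by rewrite invr_gt0.
have /choice[u uF] : forall k, exists f, F (ball f (k.+1%:R^-1)%:C%C).
  by move=> k; apply: Fc; rewrite ltcR.
have small (e : R) : 0 < e -> exists N, forall n, (N <= n)%N -> n.+1%:R^-1 < e.
  by move=> /posnumP[d]; have [N _ NP] := near_infty_natSinv_lt d; exists N.
have close m n : l2_rnorm (u m - u n) < m.+1%:R^-1 + n.+1%:R^-1.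
  have [h [hm hn]] := filter_ex (filterI (uF m) (uF n)).
  rewrite l2_ball in hm; rewrite l2_ball in hn.
  rewrite -(subrK h (u m)) -addrA; apply: le_lt_trans (l2_rnormD _ _) _.
  by rewrite ltrD// l2_rnormB.
have [l ul] : exists l, forall e : R, 0 < e -> exists N, forall n, (N <= n)%N ->
    l2_rnorm (u n - l) <= e.
  apply: l2_seq_complete => e e0; have [|N NP] := small (e / 2).
    by rewrite divr_gt0.
  exists N => m n Nm Nn; apply/ltW/(lt_trans (close m n)).
  by rewrite [ltRHS]splitr ltrD// NP.
apply/cvg_ex; exists l; apply/cvgrPdist_lt => e e0.
have [r re r0] : exists2 r : R, e = r%:C%C & 0 < r.
  by exists (Re e); [rewrite RRe_real// gtr0_real|rewrite -ltcR RRe_real// gtr0_real].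
have r2 : 0 < r / 2 by rewrite divr_gt0.
have [N NP] := ul _ r2; have [N' N'P] := small _ r2.
apply: filterS (uF (maxn N N')) => h; rewrite l2_ball => hu.
rewrite re l2_rnormE ltcR -(subrK (u (maxn N N')) l) -addrA.
apply: le_lt_trans (l2_rnormD _ _) _; rewrite [ltRHS]splitr ler_ltD//.
  by rewrite l2_rnormB NP// leq_maxl.
by apply: lt_trans hu _; rewrite N'P// leq_maxr.
Qed.

HB.instance Definition _ := Uniform_isComplete.Build (l2 R) l2_complete.

End EllTwoInner.

Canonical l2_hilbert (R : realType) : hilbertType R := HilbertType (@l2_normE R).

Section WeightedShift.
Context {R : realType}.
Implicit Types (a : R^nat) (x : nat -> R[i]) (f : l2 R).

Lemma bounded_funP a : bounded_fun a <-> exists M, forall n, `|a n| <= M.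
Proof.
split=> [[M [Mreal /(_ (`|M| + 1))]]|[M aM]].
  rewrite (le_lt_trans (ler_norm _)) ?ltrDl// => /(_ erefl) aM.
  by exists (`|M| + 1) => n; exact: aM.
exists M; split; first exact: num_real.
by move=> y My n _ /=; exact: le_trans (aM n) (ltW My).
Qed.

Definition shift_seq a x (n : nat) : R[i] :=
  if n is m.+1 then (a m)%:C%C * x m else 0.

Lemma sqnormcZ (c : R) (z : R[i]) : sqnormc (c%:C%C * z) = c ^+ 2 * sqnormc z.
Proof. by rewrite sqnormcM /sqnormc/= expr0n addr0. Qed.

Lemma shift_partial_le a f (M : R) n : (forall n, `|a n| <= M) ->
  \sum_(0 <= k < n) sqnormc (shift_seq a f k) <= (M * l2_rnorm f) ^+ 2.
Proof.
move=> aM; case: n => [|n]; first by rewrite big_nil sqr_ge0.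
rewrite big_nat_recl//= [sqnormc 0](_ : _ = 0) ?add0r; last first.
  by apply/eqP; rewrite sqnormc_eq0.
rewrite exprMn; apply: (@le_trans _ _ (M ^+ 2 * \sum_(0 <= k < n) sqnormc (f k))).
  rewrite mulr_sumr; apply: ler_sum => k _; rewrite sqnormcZ.
  apply: ler_wpM2r; first exact: sqnormc_ge0.
  rewrite -(real_normK (num_real (a k))) (@ler_pXn2r _ 2)// nnegrE.
  exact: le_trans (aM 0%N).
by apply: ler_wpM2l; [exact: sqr_ge0|exact: l2_partial_rnorm].
Qed.

Lemma shift_seq_ell2 a f : bounded_fun a -> shift_seq a f \in ell2 R.
Proof.
move=> /bounded_funP[M aM]; apply: ell2_bounded => n; exact: shift_partial_le.
Qed.

(* Only meaningful for bounded weights; wshift a is 0 otherwise. *)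
Definition wshift a f : l2 R :=
  if pselect (bounded_fun a) is left ba then L2 (shift_seq_ell2 f ba) else 0.

Lemma wshiftE a f n : bounded_fun a -> wshift a f n = shift_seq a f n.
Proof. by move=> ba; rewrite /wshift; case: pselect. Qed.

Lemma wshift_linear a : linear (wshift a).
Proof.
move=> c f g; have [ba|nba] := pselect (bounded_fun a); last first.
  by rewrite /wshift; case: pselect => // _; rewrite scaler0 addr0.
apply/val_inj/funext => n.
rewrite -[LHS]/(wshift a (c *: f + g) n).
rewrite -[RHS]/(c * wshift a f n + wshift a g n) !wshiftE//.
case: n => [|n] /=; first by rewrite mulr0 addr0.
rewrite [LHS](_ : _ = (a n)%:C%C * (c * f n + g n))//.
by rewrite mulrDr mulrCA.
Qed.

HB.instance Definition _ a := GRing.isLinear.Build R[i] (l2 R) (l2 R) _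
  (wshift a) (wshift_linear a).

Lemma wshift_bounded a : bounded_fun a ->
  bounded_op (wshift a : {linear l2_hilbert R -> l2_hilbert R}).
Proof.
move=> ba; have /bounded_funP[M aM] := ba; exists M => f.
have M0 : 0 <= M by exact: le_trans (aM 0%N).
change (`|wshift a f| <= M%:C%C * `|f|).
rewrite !l2_rnormE -rmorphM lecR; apply: l2_rnorm_le => [|n].
  by rewrite mulr_ge0 ?l2_rnorm_ge0.
under eq_bigr do rewrite wshiftE//.
exact: shift_partial_le.
Qed.

Lemma unit_seq_ell2 n : (fun k => (k == n)%:R : R[i]) \in ell2 R.
Proof.
apply: (@ell2_bounded _ _ 1) => m.
have E k : sqnormc ((k == n)%:R : R[i]) = (k == n)%:R :> R.
  by case: (k == n); rewrite /sqnormc/= ?expr1n ?expr0n/= ?addr0.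
under eq_bigr do rewrite E.
rewrite -natr_sum -[1]/(1%:R) ler_nat -big_mkcond/=.
by rewrite sum1_count count_uniq_mem ?leq_b1// iota_uniq.
Qed.

Definition l2_unit n : l2 R := L2 (unit_seq_ell2 n).

Lemma wshift_unit a n : bounded_fun a ->
  wshift a (l2_unit n) = (a n)%:C%C *: l2_unit n.+1.
Proof.
move=> ba; apply/val_inj/funext => k.
rewrite -[LHS]/(wshift a (l2_unit n) k) wshiftE//.
rewrite -[RHS]/((a n)%:C%C * (k == n.+1)%:R).
case: k => [|k] /=; first by rewrite mulr0.
by rewrite eqSS; case: eqVneq => [->//|]; rewrite !mulr0.
Qed.

Definition moment a (n : nat) : R := \prod_(j < n) a j ^+ 2.

Definition schur_pow a (p : R) : R^nat := fun n => a n `^ p.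

Lemma bounded_schur_pow a (p : R) : 0 < p -> (forall n, 0 < a n) ->
  bounded_fun a -> bounded_fun (schur_pow a p).
Proof.
move=> p0 a0 /bounded_funP[M aM]; apply/bounded_funP; exists (M `^ p) => n.
have {}aM : a n <= M by apply: le_trans (aM n); exact: ler_norm.
rewrite ger0_norm ?powR_ge0//; apply: ge0_ler_powR; rewrite ?nnegrE ?(ltW p0) ?(ltW (a0 n))//.
exact: le_trans (ltW (a0 n)) aM.
Qed.

Definition subnormal_shift a : Prop :=
  subnormal (wshift a : {linear l2_hilbert R -> l2_hilbert R}).

Definition moment_infinitely_divisible a : Prop :=
  forall p : R, 0 < p -> subnormal_shift (schur_pow a p).

(* Zero weights are allowed so as to cover the moment sequence 1, 0, 0, ... *)
Definition shift_with_moments_subnormal (m : R^nat) : Prop :=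
  exists b : R^nat, [/\ forall n, 0 <= b n, bounded_fun b,
    forall n, moment b n = m n & subnormal_shift b].

Definition log_moment_ratio a : R^nat := fun n =>
  ln (moment a n * moment a n.+2 / moment a n.+1 ^+ 2).
End WeightedShift.

Section Stieltjes.
Context {R : realType}.

Definition psdmx n (A : 'M[R]_n) : Prop :=
  A^T = A /\ forall v : 'cV[R]_n, 0 <= (v^T *m A *m v) 0 0.

Definition psd_infinite (A : nat -> nat -> R) : Prop :=
  forall n (s : 'I_n -> nat), injective s ->
  psdmx (\matrix_(i < n, j < n) A (s i) (s j)).

Definition stieltjes (d : R^nat) : Prop :=
  psd_infinite (fun i j => d (i + j)%N) /\
  psd_infinite (fun i j => d (i + j).+1).
End Stieltjes.

(* Main.v *)
Require Import Defs.
From HB Require Import structures.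
From mathcomp Require Import all_boot all_order all_algebra.
From mathcomp Require Import sesquilinear complex ring lra zify.
From mathcomp Require Import all_classical all_reals.
From mathcomp Require Import topology normedtype sequences exp.

(* Since (1 - t)^2 integrates ln gamma to delta, delta is a Stieltjes moment
   sequence iff the Hankel kernels of ln gamma (and of its shift) are
   conditionally positive definite; by Schoenberg's argument (Schur products one
   way, differentiation of gamma^p at p = 0 the other way) this holds iff all
   gamma^p are Stieltjes moment sequences.
   It remains to see that a bounded shift with positive weights is subnormal iff
   its moments gamma are Stieltjes.  If N is a normal extension and x the image
   of e_0, then gamma_(i+j) = <(N* N)^i x, (N* N)^j x>.  Conversely, let P be
   the Jacobi matrix of the even measure with moments gamma_0, 0, gamma_1, 0, ...,
   which is self-adjoint with zero diagonal; then |P^k e_0|^2 = gamma_k, the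
   operator (bilateral shift) (x) P on l2(Z x N) is normal, and the vectors
   e_k (x) P^k e_0 / sqrt gamma_k span an invariant copy of the weighted shift.
   Working with the even measure avoids taking a square root of a positive
   operator. *)

Set Implicit Arguments.
Unset Strict Implicit.
Unset Printing Implicit Defensive.

Import Order.TTheory GRing.Theory Num.Theory.
Import numFieldNormedType.Exports.

Local Open Scope classical_set_scope.
Local Open Scope ring_scope.

(** * Positive Hankel functionals on polynomials *)

(** Discriminant bound, read off at the minimiser t = - y / z when z > 0; z < 0 is impossible and z
    = 0 forces y = 0. *)
Lemma sqr_le_mul_of_quadratic_ge0 {R : realFieldType} (x y z : R) :
  (forall t, 0 <= x + 2 * t * y + t ^+ 2 * z) -> y ^+ 2 <= x * z.
Proof.
move=> h; have x0 : 0 <= x by have := h 0; rewrite mulr0 mul0r expr0n mul0r !addr0.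
have [z0|z0] := eqVneq z 0.
  have [->|y0] := eqVneq y 0; first by rewrite z0 mulr0 expr0n.
  have := h (- (x + 1) / (2 * y)); rewrite z0 mulr0 addr0.
  by rewrite (_ : x + _ = - 1) ?oppr_ge0 ?ler10//; field.
have z1 : 0 < z.
  rewrite lt_neqAle eq_sym z0/= leNgt; apply/negP => zn.
  (* With u z = - (|y| + x + 1) and t = 2 u + 2 >= 2 one has t^2 z <= - 2 t (|y| + x + 1), so the
     quadratic is negative at t. *)
  have := h ((`|y| + x + 1) / - z * 2 + 2).
  set u := _ / - z; have uz : u * z = - (`|y| + x + 1) by rewrite /u; field.
  have u0 : 0 <= u by rewrite /u divr_ge0 ?oppr_ge0 ?(ltW zn)// !addr_ge0.
  have : y <= `|y| := ler_norm y. have : 0 <= `|y| := normr_ge0 y.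
  by nra.
have := h (- y / z).
rewrite (_ : _ + _ = (x * z - y ^+ 2) / z); last by field.
by rewrite pmulr_lge0 ?invr_gt0// subr_ge0.
Qed.

(** Log-convexity makes the ratios t (k + 1) / t k nondecreasing; a first ratio r > B would give
    growth at least like r ^ k, too fast for C B ^ k. *)
Lemma logconvex_ratio_le {R : realType} (t : R^nat) (B C : R) : 0 <= B ->
  (forall k, 0 <= t k) -> (forall k, t k.+1 ^+ 2 <= t k * t k.+2) ->
  (forall k, t k <= C * B ^+ k) -> t 1%N <= B * t 0%N.
Proof.
move=> B0 t0 tc tB; rewrite leNgt; apply/negP => h.
have t00 : 0 < t 0%N.
  rewrite lt_neqAle t0 andbT; apply/eqP => e.
  have := tc 0%N; rewrite -e mul0r => /(conj (sqr_ge0 (t 1%N)))/andP.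
  rewrite -eq_le eq_sym sqrf_eq0 => /eqP e1.
  by move: h; rewrite e1 -e mulr0 ltxx.
set r := t 1%N / t 0%N.
have rB : B < r by rewrite /r ltr_pdivlMr.
have r0 : 0 < r := le_lt_trans B0 rB.
have step k : 0 < t k /\ r * t k <= t k.+1.
  elim: k => [|k [tk rk]]; first by split=> //; rewrite /r divfK// gt_eqF.
  have tk1 : 0 < t k.+1 by apply: lt_le_trans rk; rewrite mulr_gt0.
  split => //; rewrite -(ler_pM2l tk); apply: le_trans (tc k).
  by rewrite expr2 mulrA ler_wpM2r ?(ltW tk1)// mulrC.
have grow k : t 0%N * r ^+ k <= C * B ^+ k.
  apply: le_trans (tB k); elim: k => [|k ih]; first by rewrite expr0 mulr1.
  by rewrite exprS mulrCA; apply: le_trans (step k).2; rewrite ler_wpM2l// ltW.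
have [B00|Bn0] := eqVneq B 0.
  by have := grow 1%N; rewrite B00 !expr1 mulr0 leNgt mulr_gt0.
have Bp : 0 < B by rewrite lt_neqAle eq_sym Bn0.
set q := r / B - 1; have q0 : 0 < q by rewrite subr_gt0 ltr_pdivlMr// mul1r.
have bern k : 1 + k%:R * q <= (r / B) ^+ k.
  elim: k => [|k ih]; first by rewrite mul0r addr0 expr0.
  rewrite exprS (_ : r / B = 1 + q); last by rewrite /q addrC subrK.
  have : 0 <= k%:R :> R by [].
  rewrite (_ : r / B = 1 + q) in ih; last by rewrite /q addrC subrK.
  set z := (1 + q) ^+ k in ih *; move=> k0.
  rewrite -natr1; apply: le_trans (_ : (1 + q) * (1 + k%:R * q) <= _).
    by nra.
  by rewrite ler_wpM2l// addr_ge0// ltW.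
have bd k : k%:R * (t 0%N * q) <= C.
  have := grow k; rewrite -ler_pdivrMr ?exprn_gt0// -mulrA -expr_div_n.
  apply: le_trans; rewrite mulrCA ler_wpM2l ?(ltW t00)//.
  by apply: le_trans (bern k); rewrite lerDr.
have tq : 0 < t 0%N * q by rewrite mulr_gt0.
have := bd (Num.bound `|C / (t 0%N * q)|).
rewrite leNgt -ltr_pdivrMr//; move/negP; apply.
by apply: le_lt_trans (ler_norm _) _; exact/archi_boundP/normr_ge0.
Qed.

Section Functional.
Context {R : realType}.
Implicit Types (d : R^nat) (p q : {poly R}).

(** The Riesz functional of [d], with value d n at X^n; it is integration against mu when [d] is the
    moment sequence of mu. *)
Definition momf d p : R := \sum_(i < size p) p`_i * d i.

Lemma momf_widen d p n : (size p <= n)%N -> momf d p = \sum_(i < n) p`_i * d i.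
Proof.
move=> pn; rewrite /momf (big_ord_widen _ (fun i => p`_i * d i) pn) big_mkcond.
by apply: eq_bigr => i _; case: ltnP => // pi; rewrite nth_default// mul0r.
Qed.

Lemma momf_is_linear d : scalar (momf d).
Proof.
move=> c p q; pose n := maxn (size p) (size q).
have sn : (size (c *: p + q)%R <= n)%N.
  rewrite (leq_trans (size_polyD _ _))// geq_max leq_maxr andbT.
  by rewrite (leq_trans (size_scale_leq _ _))// leq_maxl.
rewrite (momf_widen _ sn) (momf_widen _ (leq_maxl _ _ : size p <= n)%N).
rewrite (momf_widen _ (leq_maxr _ _ : size q <= n)%N) mulr_sumr -big_split.
by apply: eq_bigr => i _; rewrite coefD coefZ mulrDl mulrA.
Qed.
HB.instance Definition _ d :=
  GRing.isLinear.Build R {poly R} R _ (momf d) (momf_is_linear d).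

Lemma momfZ d c p : momf d (c *: p) = c * momf d p.
Proof. exact: linearZ. Qed.

Lemma momfD d p q : momf d (p + q) = momf d p + momf d q.
Proof. exact: linearD. Qed.

Lemma momfB d p q : momf d (p - q) = momf d p - momf d q.
Proof. exact: linearB. Qed.

Lemma momf0 d : momf d 0 = 0.
Proof. exact: linear0. Qed.

Lemma momfMn d p n : momf d (p *+ n) = momf d p *+ n.
Proof. exact: linearMn. Qed.

Lemma momf_sum d (I : Type) (s : seq I) (P : pred I) (F : I -> {poly R}) :
  momf d (\sum_(i <- s | P i) F i) = \sum_(i <- s | P i) momf d (F i).
Proof. exact: linear_sum. Qed.

Lemma momfXn d n : momf d 'X^n = d n.
Proof.
rewrite /momf size_polyXn (bigD1 ord_max)//= coefXn eqxx mul1r big1 ?addr0// => i ni.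
by rewrite coefXn (_ : _ == _ = false) ?mul0r//; apply/negbTE.
Qed.

Lemma momf_mulX d p : momf d ('X * p) = momf (fun n => d n.+1) p.
Proof.
have sX : (size ('X * p)%R <= (size p).+1)%N.
  by rewrite (leq_trans (size_polyMleq _ _))// size_polyX.
rewrite (momf_widen _ sX) big_ord_recl coefXM mul0r add0r.
by apply: eq_bigr => i _; rewrite coefXM.
Qed.

Lemma momf_sqr d n (c : 'I_n -> R) (s : 'I_n -> nat) :
  momf d ((\sum_(i < n) c i *: 'X^(s i)) ^+ 2) =
  \sum_(i < n) \sum_(j < n) c i * c j * d (s i + s j)%N.
Proof.
rewrite expr2 mulr_suml momf_sum; apply: eq_bigr => i _.
rewrite mulr_sumr momf_sum; apply: eq_bigr => j _.
by rewrite -scalerAl -scalerAr -exprD !momfZ momfXn mulrA.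
Qed.
End Functional.

Section Positivity.
Context {R : realType}.
Implicit Types (d : R^nat) (p q : {poly R}).

(** The form of a Hankel submatrix at v is the functional at the square of the polynomial with
    coefficients v at the exponents s i; every polynomial arises with s i = i. *)
Lemma psd_hankelP d : psd_infinite (fun i j => d (i + j)%N) <->
  forall p, 0 <= momf d (p ^+ 2).
Proof.
have E n (s : 'I_n -> nat) (v : 'cV[R]_n) :
    (v^T *m (\matrix_(i < n, j < n) d (s i + s j)%N) *m v) 0 0 =
    momf d ((\sum_(i < n) v i 0 *: 'X^(s i)) ^+ 2).
  rewrite momf_sqr [RHS]exchange_big mxE; apply: eq_bigr => j _ /=.
  by rewrite !mxE mulr_suml; apply: eq_bigr => i _; rewrite !mxE mulrAC.
split=> [h p|h n s _].
  have [_ /(_ (\col_i p`_i))] := h (size p) val val_inj.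
  rewrite E -[X in _ -> _ <= momf d (X ^+ 2)]coefK poly_def; congr (0 <= momf d (_ ^+ 2)).
  by apply: eq_bigr => i _; rewrite mxE.
split; first by apply/matrixP => i j; rewrite !mxE addnC.
by move=> v; rewrite E.
Qed.

Lemma stieltjesP d : stieltjes d <->
  forall p, 0 <= momf d (p ^+ 2) /\ 0 <= momf d ('X * p ^+ 2).
Proof.
have H := psd_hankelP d; have H' := psd_hankelP (fun n => d n.+1).
split=> [[/H h /H' h'] p|h]; first by rewrite momf_mulX.
by split; [apply/H => p|apply/H' => p; rewrite -momf_mulX]; have [] := h p.
Qed.

Lemma momf_CauchySchwarz d p q : (forall r, 0 <= momf d (r ^+ 2)) ->
  momf d (p * q) ^+ 2 <= momf d (p ^+ 2) * momf d (q ^+ 2).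
Proof.
move=> h; apply: sqr_le_mul_of_quadratic_ge0 => t.
have := h (p + t *: q); congr (0 <= _).
rewrite sqrrD -scalerAr exprZn -mulr_natl -[2 * t * _]mulrA.
by rewrite !momfD momfZ mulr_natl momfMn momfZ mulr_natl.
Qed.

Lemma stieltjes_ge0 d : stieltjes d -> forall n, 0 <= d n.
Proof.
move=> /stieltjesP h n; rewrite -(odd_double_half n) -mul2n.
have [h0 h1] := h 'X^(n./2); case: (odd n).
  by move: h1; rewrite -exprM -exprS momfXn mulnC.
by move: h0; rewrite -exprM momfXn mulnC.
Qed.

Lemma stieltjes_shift d : stieltjes d -> stieltjes (fun n => d n.+1).
Proof.
move=> /stieltjesP h; apply/stieltjesP => p; rewrite -!momf_mulX.
split; first by have [] := h p.
by have [+ _] := h ('X * p); rewrite exprMn expr2 -mulrA.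
Qed.

(** Cauchy-Schwarz for 1 and X, carried to index n by shifting the sequence. *)
Lemma stieltjes_logconvex d n : stieltjes d -> d n.+1 ^+ 2 <= d n * d n.+2.
Proof.
elim: n d => [|n ih] d hd; last exact: (ih _ (stieltjes_shift hd)).
have /(momf_CauchySchwarz 1 'X) : forall r, 0 <= momf d (r ^+ 2).
  by move=> r; have /stieltjesP/(_ r)[] := hd.
rewrite mul1r expr1n; have := (momfXn d 0, momfXn d 1, momfXn d 2).
by rewrite expr0 expr1 => -[[-> ->] ->].
Qed.

Lemma stieltjesZ c d : 0 <= c -> stieltjes d -> stieltjes (fun n => c * d n).
Proof.
move=> c0 /stieltjesP h; apply/stieltjesP => p.
have E q : momf (fun n => c * d n) q = c * momf d q.
  by rewrite /momf mulr_sumr; apply: eq_bigr => i _; rewrite mulrCA.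
by rewrite !E; split; rewrite mulr_ge0//; have [] := h p.
Qed.
End Positivity.

(** * Schur product theorem *)

Section SchurProduct.
Context {R : realFieldType}.
Implicit Types (A B : nat -> nat -> R) (c : nat -> R).

Definition psd_upto n A : Prop := (forall i j, A i j = A j i) /\
  forall c, 0 <= \sum_(i < n) \sum_(j < n) c i * c j * A i j.

Lemma psd_upto_pred n A : psd_upto n.+1 A -> psd_upto n A.
Proof.
move=> [As Ap]; split=> // c.
have := Ap (fun i => if (i < n)%N then c i else 0); congr (0 <= _).
rewrite big_ord_recr/= ltnn [X in _ + X]big1 ?addr0; last by move=> i _; rewrite !mul0r.
apply: eq_bigr => i _; rewrite big_ord_recr/= ltnn mulr0 mul0r addr0.
by apply: eq_bigr => j _; rewrite !ltn_ord.
Qed.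

(** Cauchy-Schwarz between c and the last basis vector, from the form at c + t e_n. *)
Lemma psd_upto_pivot n A c : psd_upto n.+1 A ->
  (\sum_(i < n.+1) c i * A i n) ^+ 2 <=
  A n n * \sum_(i < n.+1) \sum_(j < n.+1) c i * c j * A i j.
Proof.
move=> [As Ap]; rewrite mulrC; apply: sqr_le_mul_of_quadratic_ge0 => t.
have := Ap (fun i => c i + t * (i == n)%:R); congr (0 <= _).
have del (F : nat -> R) : \sum_(i < n.+1) (i == n :> nat)%:R * F i = F n.
  rewrite big_ord_recr/= eqxx mul1r big1 ?add0r// => i _.
  by rewrite ltn_eqF ?ltn_ord// mul0r.
transitivity (\sum_(i < n.+1) (\sum_(j < n.+1) c i * c j * A i j +
   t * (c i * A i n) + t * ((i == n :> nat)%:R * \sum_(j < n.+1) c j * A i j)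
   + t ^+ 2 * ((i == n :> nat)%:R * A i n))).
  apply: eq_bigr => i _; rewrite -(del (fun j => c i * A i j)).
  rewrite -(del (fun j => A i j)) !mulr_sumr -!big_split/=.
  by apply: eq_bigr => j _; ring.
rewrite !big_split/= -!mulr_sumr (del (fun i => \sum_(j < n.+1) c j * A i j)).
rewrite (del (fun i => A i n)) mulr_natl mulr2n mulrDl.
rewrite [in X in _ + t * X + _](eq_bigr (fun j : 'I_n.+1 => c j * A j n)) ?addrA// => j _.
by rewrite As.
Qed.

(* Pivoting on the last row writes A as a rank one matrix plus a positive
   semi-definite one whose last row vanishes; when the pivot is 0 the row
   vanishes already, in accordance with x / 0 = 0. *)
Lemma psd_upto_schur n A B : psd_upto n A -> psd_upto n B ->
  psd_upto n (fun i j => A i j * B i j).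
Proof.
elim: n A => [|n ih] A hA hB.
  split=> [i j|c]; first by rewrite hA.1 hB.1.
  by rewrite big_ord0.
have [As Ap] := hA.
have A_piv i : (i <= n)%N -> A n n = 0 -> A i n = 0.
  move=> ni An0.
  have := psd_upto_pivot (fun j => (j == i)%:R) hA.
  rewrite An0 mul0r (bigD1 (Ordinal (ni : (i < n.+1)%N)))//= eqxx mul1r big1 ?addr0.
    by move=> h; apply/eqP; rewrite -sqrf_eq0 eq_le h sqr_ge0.
  by move=> j /negbTE; rewrite -val_eqE/= => ->; rewrite mul0r.
have Ann : 0 <= A n n.
  have := Ap (fun j => (j == n)%:R).
  rewrite big_ord_recr/= big1 ?add0r; last first.
    by move=> i _; rewrite big1// => j _; rewrite ltn_eqF ?ltn_ord// !mul0r.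
  rewrite big_ord_recr/= big1 ?add0r ?eqxx ?mul1r//.
  by move=> i _; rewrite (ltn_eqF (ltn_ord i)) mulr0 mul0r.
pose A' i j := A i j - A i n * A j n / A n n.
have hA' : psd_upto n.+1 A'.
  split=> [i j|c]; first by rewrite /A' As [A i n * _]mulrC.
  pose S := \sum_(i < n.+1) \sum_(j < n.+1) c i * c j * A i j.
  pose r := \sum_(i < n.+1) c i * A i n.
  rewrite (_ : \sum_i _ = S - r ^+ 2 / A n n).
    rewrite subr_ge0; have := psd_upto_pivot c hA; rewrite -/S -/r => le.
    have [An0|An0] := eqVneq (A n n) 0; first by rewrite An0 invr0 mulr0; exact: Ap.
    by rewrite ler_pdivrMr ?lt_neqAle ?Ann 1?eq_sym ?An0// mulrC.
  rewrite /S expr2 /r !mulr_suml -sumrB; apply: eq_bigr => i _.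
  rewrite mulr_sumr mulr_suml -sumrB; apply: eq_bigr => j _.
  by rewrite /A'; ring.
have A'0 i : (i <= n)%N -> A' i n = 0.
  move=> ni; rewrite /A'; have [An0|An0] := eqVneq (A n n) 0; last by rewrite mulfK// subrr.
  by rewrite An0 mulr0 mul0r subr0 A_piv.
split=> [i j|c]; first by rewrite As hB.1.
(* The last row of [A'] vanishes, so its product with B lives on the first n indices; the rank one
   rest gives the form of B at c i * A i n, divided by the pivot. *)
have [_ /(_ c)] := ih A' (psd_upto_pred hA') (psd_upto_pred hB).
set S1 := (X in 0 <= X) => S1_ge0.
have := hB.2 (fun i => c i * A i n); set S2 := (X in 0 <= X) => S2_ge0.
rewrite (_ : \sum_i _ = S1 + S2 / A n n); first by rewrite addr_ge0// divr_ge0.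
have -> : S1 = \sum_(i < n.+1) \sum_(j < n.+1) c i * c j * (A' i j * B i j).
  rewrite /S1 [RHS]big_ord_recr/= [X in _ + X]big1 ?addr0.
    apply: eq_bigr => i _; rewrite [RHS]big_ord_recr/= A'0 ?(ltnW (ltn_ord i))//.
    by rewrite mul0r mulr0 addr0.
  by move=> j _; rewrite hA'.1 A'0 ?mul0r ?mulr0// -ltnS.
rewrite /S2 mulr_suml -big_split; apply: eq_bigr => i _ /=.
rewrite mulr_suml -big_split; apply: eq_bigr => j _ /=.
by rewrite /A'; ring.
Qed.
End SchurProduct.

(** * Schoenberg correspondence *)

Section Schoenberg.
Context {R : realType}.
Implicit Types (m : R^nat) (A : nat -> nat -> R) (p q r : {poly R}).

Lemma cvgn_sum_ord n (F : 'I_n -> R^nat) (l : 'I_n -> R) :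
  (forall i, F i @ \oo --> l i) ->
  (fun N => \sum_(i < n) F i N) @ \oo --> \sum_(i < n) l i.
Proof.
elim: n F l => [|n ih] F l Fl.
  by under eq_fun do rewrite big_ord0; rewrite big_ord0; exact: cvg_cst.
under eq_fun do rewrite big_ord_recl; rewrite big_ord_recl.
by apply: cvgD => //; exact: ih.
Qed.

(** The partial sums of the exponential series combine Schur powers with nonnegative coefficients,
    and positivity passes to the limit. *)
Lemma psd_upto_exp n A : psd_upto n A -> psd_upto n (fun i j => expR (A i j)).
Proof.
move=> hA.
have pow k : psd_upto n (fun i j => A i j ^+ k).
  elim: k => [|k ih].
    split=> // c; rewrite (_ : \sum_i _ = (\sum_(i < n) c i) ^+ 2) ?sqr_ge0//.
    rewrite expr2 mulr_suml; apply: eq_bigr => i _; rewrite mulr_sumr.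
    by apply: eq_bigr => j _; rewrite mulr1.
  have [s p] := psd_upto_schur hA ih; split=> [i j|c]; first by rewrite hA.1.
  by have := p c; congr (0 <= _); do 2!apply: eq_bigr => ? _; rewrite exprS.
split=> [i j|c]; first by rewrite hA.1.
pose u N := \sum_(i < n) \sum_(j < n) c i * c j * series (exp_coeff (A i j)) N.
have uE N : 0 <= u N.
  rewrite (_ : u N = \sum_(0 <= k < N) k`!%:R^-1 *
    \sum_(i < n) \sum_(j < n) c i * c j * A i j ^+ k).
    by apply: sumr_ge0 => k _; rewrite mulr_ge0 ?invr_ge0//; exact: (pow k).2.
  rewrite /u; under [RHS]eq_bigr do rewrite mulr_sumr.
  rewrite [RHS]exchange_big; apply: eq_bigr => i _ /=.
  under [RHS]eq_bigr do rewrite mulr_sumr.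
  rewrite [RHS]exchange_big; apply: eq_bigr => j _ /=.
  rewrite /series/= mulr_sumr; apply: eq_bigr => k _.
  by rewrite /exp_coeff/= mulrA mulrC.
have cu : u @ \oo --> \sum_(i < n) \sum_(j < n) c i * c j * expR (A i j).
  do 2!apply: cvgn_sum_ord => ?; apply: cvgM; first exact: cvg_cst.
  exact: is_cvg_series_exp_coeff.
rewrite -(cvg_lim _ cu)//; apply: limr_ge; first by apply/cvg_ex; eexists; exact: cu.
by apply: nearW => N; exact: uE.
Qed.

Lemma horner1_factor p : p.[1] = 0 -> exists q, p = (1 - 'X) * q.
Proof.
move=> /eqP/factor_theorem[q ->]; exists (- q).
by rewrite mulrN -mulNr opprB mulrC.
Qed.

(* Schoenberg's argument: K normalises the kernel m (i + j) at the base point 0,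
   which makes it positive and changes the exponential by a rank one factor. *)
Lemma exp_cond_psd m (t : R) : 0 <= t ->
  (forall q, 0 <= momf m (((1 - 'X) * q) ^+ 2)) ->
  forall q, 0 <= momf (fun n => expR (t * m n)) (q ^+ 2).
Proof.
move=> t0 h q; rewrite -(coefK q) poly_def momf_sqr.
set n := size q.
pose K i j := t * (m (i + j)%N - m i - m j + m 0%N).
have hK : psd_upto n K.
  split=> [i j|c]; first by rewrite /K addnC; ring.
  (* [p] vanishes at 1, hence is a multiple of 1 - X; t times the functional at p^2 is the form of
     [K]. *)
  pose p : {poly R} := \sum_(i < n) c i *: ('X^i - 1).
  have [r pE] : exists r, p = (1 - 'X) * r.
    apply: horner1_factor; rewrite horner_sum big1// => i _.
    by rewrite !hornerE expr1n subrr mulr0.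
  have := h r; rewrite -pE => p0.
  rewrite (_ : \sum_i _ = t * momf m (p ^+ 2)) ?mulr_ge0//.
  rewrite expr2 mulr_suml momf_sum mulr_sumr; apply: eq_bigr => i _.
  rewrite /p [c i *: _ * _]mulr_sumr momf_sum mulr_sumr; apply: eq_bigr => j _.
  rewrite -[c i *: _ * _]scalerAl -[_ * (c j *: _)]scalerAr !momfZ.
  have -> : ('X^i - 1) * ('X^j - 1) = 'X^(i + j) - 'X^i - 'X^j + 'X^0 :> {poly R}.
    by rewrite exprD expr0; ring.
  by rewrite !(momfB, momfD) !momfXn /K; ring.
(* The weights exp (t m i) undo the normalisation up to the factor exp (- t m 0). *)
have [_ /(_ (fun i => q`_i * expR (t * m i)))] := psd_upto_exp hK.
set S := (X in 0 <= X) => S0.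
rewrite (_ : \sum_i _ = expR (- (t * m 0%N)) * S) ?mulr_ge0 ?expR_ge0//.
rewrite /S mulr_sumr; apply: eq_bigr => i _; rewrite mulr_sumr; apply: eq_bigr => j _.
rewrite (_ : t * m (i + j)%N = - (t * m 0%N) + (t * m i + (t * m j + K i j))).
  by rewrite !expRD; ring.
by rewrite /K; ring.
Qed.

(** Derivative of s |-> exp (s x) at 0 along s = 1 / (k + 1); both squeezing bounds come from 1 + y
    <= exp y, used at y and at - y. *)
Lemma cvg_expR_diff_quotient (x : R) :
  (fun k => k.+1%:R * (expR (k.+1%:R^-1 * x) - 1)) @ \oo --> x.
Proof.
have k0 k : 0 < k.+1%:R :> R by [].
apply: (@squeeze_cvgr _ _ _ _ (fun=> x) (fun k => x * expR (k.+1%:R^-1 * x))).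
- apply: nearW => k; set y := _^-1 * x.
  have -> : x = k.+1%:R * y by rewrite /y mulVKf ?gt_eqF.
  rewrite -mulrA !ler_pM2l//; apply/andP; split.
    by rewrite lerBrDl expR_ge1Dx.
  have := expR_ge1Dx (- y); rewrite -(ler_pM2r (expR_gt0 y)) -expRD addNr expR0.
  by rewrite mulrDl mul1r mulNr => ?; rewrite lerBlDr -lerBlDl.
- exact: cvg_cst.
- suff : x * expR (k.+1%:R^-1 * x) @[k --> \oo] --> x * expR (0 * x).
    by rewrite mul0r expR0 mulr1.
  apply: cvgM; first exact: cvg_cst.
  apply: continuous_cvg; first exact: continuous_expR.
  by apply: cvgM; [exact: cvg_harmonic|exact: cvg_cst].
Qed.

Lemma cond_psd_of_exp m :
  (forall t q, 0 < t -> 0 <= momf (fun n => expR (t * m n)) (q ^+ 2)) ->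
  forall q, 0 <= momf m (((1 - 'X) * q) ^+ 2).
Proof.
move=> h q; set p := (_ * q) ^+ 2.
(* As [p] vanishes at 1, its coefficients sum to 0; subtracting 1 from each exponential changes
   nothing, so the difference quotients at t = 0 keep their sign. *)
have p1 : \sum_(i < size p) p`_i = 0.
  have : p.[1] = 0 by rewrite /p !hornerE subrr mul0r expr0n.
  by rewrite horner_coef => e; rewrite -[RHS]e; apply: eq_bigr => i _; rewrite expr1n mulr1.
pose u k := \sum_(i < size p) p`_i * (k.+1%:R * (expR (k.+1%:R^-1 * m i) - 1)).
have u0 k : 0 <= u k.
  have := h k.+1%:R^-1 ((1 - 'X) * q); rewrite invr_gt0 ltr0n => /(_ erefl).
  rewrite -/p -(@pmulr_rge0 _ k.+1%:R)//; congr (0 <= _).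
  rewrite -[momf _ p]subr0 -[X in _ - X]p1 -sumrB mulr_sumr.
  by apply: eq_bigr => i _; rewrite mulrCA [p`_i * (_ - _)]mulrBr mulr1.
have cu : u @ \oo --> momf m p.
  by apply: cvgn_sum_ord => i; apply: cvgM; [exact: cvg_cst|exact: cvg_expR_diff_quotient].
rewrite -(cvg_lim _ cu)//; apply: limr_ge; first by apply/cvg_ex; eexists; exact: cu.
by apply: nearW => N; exact: u0.
Qed.
End Schoenberg.

(** * Second differences of the logarithms of the moments *)

Section LogMoments.
Context {R : realType}.
Variable a : R^nat.
Hypothesis a_gt0 : forall n, 0 < a n.

Lemma moment_gt0 n : 0 < moment a n.
Proof. by apply: prodr_gt0 => i _; rewrite exprn_gt0. Qed.

Lemma moment_schur_pow t n :
  moment (schur_pow a t) n = expR (t * ln (moment a n)).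
Proof.
rewrite /moment; elim: n => [|n ih]; first by rewrite !big_ord0 ln1 mulr0 expR0.
have mn : 0 < \prod_(j < n) a j ^+ 2 by exact: moment_gt0.
rewrite !big_ord_recr/= ih lnM ?posrE ?exprn_gt0// mulrDr expRD; congr (_ * _).
by rewrite /schur_pow /powR gt_eqF// lnXn// mulrnAr -expRM_natl mulr_natl.
Qed.

Lemma log_moment_ratioE n : log_moment_ratio a n =
  ln (moment a n) - 2 * ln (moment a n.+1) + ln (moment a n.+2).
Proof.
rewrite /log_moment_ratio lnM ?posrE ?mulr_gt0 ?invr_gt0 ?exprn_gt0 ?moment_gt0//.
rewrite lnM ?posrE ?moment_gt0// lnV ?posrE ?exprn_gt0 ?moment_gt0//.
by rewrite lnXn ?moment_gt0// -mulr_natl; ring.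
Qed.

(** Multiplication by (1 - X)^2 is dual to the second difference. *)
Lemma momf_log_moment_ratio p : momf (log_moment_ratio a) p =
  momf (fun n => ln (moment a n)) ((1 - 'X) ^+ 2 * p).
Proof.
set l := fun n => _.
have -> : (1 - 'X) ^+ 2 * p = p - 2 *: ('X * p) + 'X * ('X * p).
  by rewrite scaler_nat -mulr_natl; ring.
rewrite momfD momfB momfZ !momf_mulX /momf mulr_sumr -sumrB -big_split.
by apply: eq_bigr => i _ /=; rewrite log_moment_ratioE /l; ring.
Qed.

Lemma stieltjes_log_moment_ratio : stieltjes (log_moment_ratio a) <->
  forall t, 0 < t -> stieltjes (moment (schur_pow a t)).
Proof.
pose l n := ln (moment a n).
have E0 q : momf (log_moment_ratio a) (q ^+ 2) = momf l (((1 - 'X) * q) ^+ 2).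
  by rewrite momf_log_moment_ratio exprMn.
have E1 q : momf (log_moment_ratio a) ('X * q ^+ 2) =
    momf (fun n => l n.+1) (((1 - 'X) * q) ^+ 2).
  by rewrite momf_log_moment_ratio mulrCA momf_mulX exprMn.
have M t q : momf (moment (schur_pow a t)) q = momf (fun n => expR (t * l n)) q.
  by apply: eq_bigr => i _; rewrite moment_schur_pow.
have MX t q : momf (moment (schur_pow a t)) ('X * q) =
    momf (fun n => expR (t * l n.+1)) q by rewrite M momf_mulX.
split=> [/stieltjesP h t t0|h]; apply/stieltjesP => q.
  rewrite M MX; split; [apply: (@exp_cond_psd _ l)|apply: (@exp_cond_psd _ (fun n => l n.+1))];
    rewrite ?(ltW t0)// => r; [rewrite -E0|rewrite -E1]; by have [] := h r.
rewrite E0 E1; split; apply: cond_psd_of_exp => t r t0.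
  by rewrite -M; have /stieltjesP/(_ r)[] := h t t0.
by rewrite -MX; have /stieltjesP/(_ r)[] := h t t0.
Qed.
End LogMoments.

(** * Moments of subnormal shifts *)

Section SubnormalMoments.
Context {R : realType}.
Implicit Types (H K : hilbertType R) (a : R^nat).

Lemma innerC H (u v : H) : inner u v = (inner v u)^*.
Proof. by have := hermC (inner (h := H)) u v; rewrite expr0 mul1r. Qed.

(** The Hankel matrix is a Gram matrix, so its form is a squared norm. *)
Lemma hankel_gram_psd H (y : nat -> H) (g : R^nat) :
  (forall i j, inner (y i) (y j) = (g (i + j)%N)%:C%C) ->
  forall p, 0 <= momf g (p ^+ 2).
Proof.
move=> yg p; rewrite -(coefK p) poly_def momf_sqr -lecR.
set n := size p; pose z := \sum_(i < n) (p`_i)%:C%C *: y i.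
have := dnorm_ge0 (inner (h := H)) z; congr (_ <= _).
rewrite {1}/z linear_sumlz rmorph_sum; apply: eq_bigr => i _.
rewrite linearZl_LR/= /z linear_sumr mulr_sumr rmorph_sum; apply: eq_bigr => j _.
rewrite linearZr_LR/= yg !rmorphM/= mulrA; congr (_ * _ * _).
by apply/CrealP; rewrite complex_real.
Qed.

Lemma l2_inner_unit n : l2_inner (l2_unit n) (l2_unit n) = 1 :> R[i].
Proof.
rewrite l2_inner_diag; set u := series _.
suff -> : limn u = 1 by [].
apply: lim_near_cst => //; exists n.+1 => // m /= nm.
rewrite /u /series/= (eq_bigr (fun k => if k == n then 1 else 0)).
  by rewrite -big_mkcond big_nat1_eq/= nm.
by move=> k _; case: (k == n); rewrite /sqnormc/= ?expr1n ?expr0n/= ?addr0.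
Qed.

Lemma iter_wshift_unit a n : bounded_fun a ->
  iter n (wshift a) (l2_unit 0) = (\prod_(j < n) a j)%:C%C *: l2_unit n.
Proof.
move=> ba; elim: n => [|n ih]; first by rewrite big_ord0 scale1r.
by rewrite iterS ih linearZ/= wshift_unit// scalerA -rmorphM big_ord_recr.
Qed.

Lemma subnormal_shift_stieltjes a : bounded_fun a -> subnormal_shift a ->
  stieltjes (moment a).
Proof.
move=> ba [K [N [V [[Nb [S [adj nrm]]] Viso VT]]]].
(* [A] is N* N; normality lets N pass through it, whence the inner product of u and A^n v is that of
   N^n u and N^n v. *)
pose A u := S (N u); pose x := V (l2_unit 0).
have symA u v : inner (A u) v = inner u (A v).
  by rewrite -adj innerC -adj -innerC.
have NA n u : N (iter n A u) = iter n A (N u).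
  by elim: n => [//|n ih]; rewrite !iterS -ih /A nrm.
have iterA n u v : inner u (iter n A v) = inner (iter n N u) (iter n N v).
  elim: n u v => [//|n ih] u v.
  by rewrite iterS -adj NA ih -!iterSr.
have gram n : inner x (iter n A x) = (moment a n)%:C%C.
  have -> : inner x (iter n A x) = inner (iter n N x) (iter n N x) by exact: iterA.
  have -> : iter n N x = V (iter n (wshift a) (l2_unit 0)).
    by elim: n => [//|n ih]; rewrite !iterS ih -VT.
  rewrite Viso iter_wshift_unit//; set z : l2_hilbert R := l2_unit n.
  rewrite linearZl_LR/= linearZr_LR/= (_ : inner z z = 1); last exact: l2_inner_unit.
  rewrite mulr1 (_ : _^* = (\prod_(j < n) a j)%:C%C); last first.
    by apply/CrealP; rewrite complex_real.
  by rewrite -rmorphM /moment -expr2 prodrXl.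
have gramA i j : inner (iter i A x) (iter j A x) = (moment a (i + j)%N)%:C%C.
  rewrite -gram; elim: i j => [//|i ih] j.
  by rewrite iterS symA -iterS ih addnS.
apply/stieltjesP => p; split; first exact: (@hankel_gram_psd _ (fun i => iter i A x)).
(* The vectors N A^i x have Gram entries gamma_(i+j+1), which gives the shifted Hankel matrix. *)
rewrite momf_mulX; apply: (@hankel_gram_psd _ (fun i => N (iter i A x))) => i j.
by rewrite adj -[S _]/(A _) -iterS gramA addnS.
Qed.
End SubnormalMoments.

(** * Jacobi matrix of the symmetrized moment sequence *)

Section Symmetrization.
Context {R : realType}.
Variable g : R^nat.
Hypothesis g_stieltjes : stieltjes g.

(* Moments of the even measure whose image under x |-> x ^ 2 has moments g. *)
Definition symmetrized (n : nat) : R := if odd n then 0 else g n./2.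

Lemma comp_polyX2E (p : {poly R}) :
  p \Po 'X^2 = \sum_(i < size p) p`_i *: 'X^(i.*2).
Proof. by rewrite comp_polyE; apply: eq_bigr => i _; rewrite -exprM mul2n. Qed.

Lemma momf_symmetrized_even p : momf symmetrized (p \Po 'X^2) = momf g p.
Proof.
rewrite comp_polyX2E momf_sum; apply: eq_bigr => i _.
by rewrite momfZ momfXn /symmetrized odd_double doubleK.
Qed.

Lemma momf_symmetrized_odd p : momf symmetrized ('X * (p \Po 'X^2)) = 0.
Proof.
rewrite comp_polyX2E mulr_sumr momf_sum big1// => i _.
by rewrite -scalerAr -exprS momfZ momfXn /symmetrized/= odd_double mulr0.
Qed.

(** In the square of e (X^2) + X o (X^2) the cross term is odd and is killed, leaving the functional
    of g at e^2 + X o^2. *)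
Lemma symmetrized_psd p : 0 <= momf symmetrized (p ^+ 2).
Proof.
have /stieltjesP h := g_stieltjes.
rewrite -(poly_even_odd p); set e := even_poly p; set o := odd_poly p.
have -> : (e \Po 'X^2 + (o \Po 'X^2) * 'X) ^+ 2 =
  (e ^+ 2 + 'X * o ^+ 2) \Po 'X^2 + 2 *: ('X * ((e * o) \Po 'X^2)).
  rewrite linearD/= !rmorphM/= comp_polyX scaler_nat -mulr_natl; ring.
rewrite momfD momf_symmetrized_even momfZ momf_symmetrized_odd mulr0 addr0 momfD.
by rewrite addr_ge0//; have [] := h e; have [] := h o.
Qed.

(** The squared norms of X^k p are log-convex by Cauchy-Schwarz and at most a constant times B ^ k,
    so the ratio bound applies. *)
Lemma momf_symmetrized_mulX_le (B : R) (p : {poly R}) : 0 <= B -> (forall n, g n <= B ^+ n) ->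
  momf symmetrized (('X * p) ^+ 2) <= B * momf symmetrized (p ^+ 2).
Proof.
move=> B0 gB; pose t k := momf symmetrized (('X^k * p) ^+ 2).
have := @logconvex_ratio_le _ t B (\sum_(i < size (p ^+ 2)) `|(p ^+ 2)`_i| * B ^+ i./2) B0.
rewrite /t expr1 expr0 mul1r; apply=> k; first exact: symmetrized_psd.
  rewrite (_ : ('X^(k.+1) * p) ^+ 2 = 'X^k * p * ('X^(k.+2) * p) :> {poly R}).
    exact: momf_CauchySchwarz symmetrized_psd.
  by rewrite !exprS; ring.
have -> : momf symmetrized (('X^k * p) ^+ 2) =
    \sum_(i < size (p ^+ 2)) (p ^+ 2)`_i * symmetrized (k.*2 + i).
  rewrite exprMn -exprM muln2 -[X in momf _ (_ * X)]coefK poly_def mulr_sumr momf_sum.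
  by apply: eq_bigr => i _; rewrite -scalerAr -exprD momfZ momfXn.
rewrite mulr_suml; apply: ler_sum => i _.
apply: (le_trans (ler_norm _)); rewrite normrM -mulrA ler_wpM2l//.
rewrite /symmetrized oddD odd_double/=; case: ifP => oi.
  by rewrite normr0 mulr_ge0 ?exprn_ge0.
rewrite halfD odd_double/= add0n doubleK ger0_norm; last exact: stieltjes_ge0.
by rewrite -exprD addnC.
Qed.
End Symmetrization.

(** * Powers of a Jacobi matrix with zero diagonal *)

Section JacobiParseval.
Context {R : realType}.
Variables (a s : R^nat) (p : nat -> nat -> R).
Hypothesis p0 : forall n, p 0%N n = (n == 0%N)%:R.
Hypothesis pS0 : forall k, p k.+1 0%N = a 0%N * p k 1%N.
Hypothesis pSS : forall k n, p k.+1 n.+1 = a n * p k n + a n.+1 * p k n.+2.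
Hypothesis p_0 : forall k, p k 0%N = s k.

(** Here p k n is coordinate n of P^k e_0, with P tridiagonal, zero on the diagonal and [a] off it;
    each application of P widens the support by one. *)
Lemma jacobi_power_eq0 k n : (k < n)%N -> p k n = 0.
Proof.
elim: k n => [|k ih] [|n]// kn.
by rewrite pSS !ih ?mulr0 ?addr0// ltnS ltnW// ltnW.
Qed.

(** Symmetry of P, truncated to indices at most n; the boundary terms carry coordinate n + 1 of P^j
    e_0 or P^k e_0 and vanish. *)
Lemma jacobi_power_sym j k n : (j <= n)%N -> (k <= n)%N ->
  \sum_(i < n.+1) p j.+1 i * p k i = \sum_(i < n.+1) p j i * p k.+1 i.
Proof.
move=> jn kn.
have E x y : (x <= n)%N -> \sum_(i < n.+1) p x.+1 i * p y i =
    \sum_(i < n) a i * p x i * p y i.+1 + \sum_(i < n) a i * p x i.+1 * p y i.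
  move=> xn; rewrite big_ord_recl/= pS0.
  rewrite (eq_bigr (fun i : 'I_n => a i * p x i * p y i.+1 + a i.+1 * p x i.+2 * p y i.+1)).
    rewrite big_split/= addrCA; congr (_ + _).
    transitivity (\sum_(i < n.+1) a i * p x i.+1 * p y i).
      by rewrite big_ord_recl.
    by rewrite big_ord_recr/= jacobi_power_eq0 ?ltnS// mulr0 mul0r addr0.
  by move=> i _; rewrite /bump/= pSS mulrDl.
rewrite E//; under [RHS]eq_bigr do rewrite mulrC.
rewrite E// addrC; congr (_ + _); apply: eq_bigr => i _; ring.
Qed.

(** Powers of P are moved to the right factor until the left one is e_0, which leaves coordinate 0
    of P^(j+l) e_0. *)
Lemma jacobi_power_parseval k : \sum_(i < k.*2.+1) p k i ^+ 2 = s k.*2.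
Proof.
have H j l n : (j + l <= n)%N -> \sum_(i < n.+1) p j i * p l i = s (j + l)%N.
  elim: j l => [|j ih] l jln.
    rewrite big_ord_recl p0 mul1r p_0 big1 ?addr0// => i _.
    by rewrite p0 mul0r.
  rewrite jacobi_power_sym; first by rewrite ih addnS.
    by rewrite (leq_trans _ jln)// addSn ltnW// ltnS leq_addr.
  by rewrite (leq_trans _ jln)// leq_addl.
by rewrite -addnn -(H _ _ _ (leqnn _)); apply: eq_bigr => i _; rewrite expr2.
Qed.
End JacobiParseval.

(** * Three-term recurrence and the entries of the Jacobi matrix *)

Section OrthogonalPolynomials.
Context {R : realType}.
Variable g : R^nat.
Hypothesis g_stieltjes : stieltjes g.
Hypothesis g0 : g 0%N = 1.
Let s := symmetrized g.

(* Monic orthogonal polynomials of s; if s is degenerate, all of them from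
   some rank on are null vectors, and the coefficients become 0 / 0 = 0. *)
Fixpoint orthopoly_pair n : {poly R} * {poly R} :=
  if n is m.+1 then
    let: (p, q) := orthopoly_pair m in
    (q, 'X * q - (momf s (q ^+ 2) / momf s (p ^+ 2)) *: p)
  else (1, 'X).
Definition orthopoly n := (orthopoly_pair n).1.
Local Notation Q := orthopoly.
Let h n := momf s (Q n ^+ 2).
Let c n := h n.+1 / h n.

Lemma orthopoly_pairE n : orthopoly_pair n = (Q n, Q n.+1).
Proof. by rewrite /Q/=; case: (orthopoly_pair n). Qed.

Lemma orthopolySS n : Q n.+2 = 'X * Q n.+1 - c n *: Q n.
Proof. by rewrite {1}/Q/= orthopoly_pairE. Qed.

Lemma mulX_orthopoly n :
  'X * Q n = Q n.+1 + (if n is m.+1 then c m *: Q m else 0).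
Proof. by case: n => [|n]; [rewrite mulr1 addr0|rewrite orthopolySS subrK]. Qed.

Lemma orthopoly0 : Q 0 = 1. Proof. by []. Qed.

Lemma orthopoly1 : Q 1 = 'X. Proof. by []. Qed.

Local Opaque orthopoly.

(** The recurrence has no middle term, so it preserves parity. *)
Lemma orthopoly_parity n : exists r, Q n = 'X^(odd n) * (r \Po 'X^2).
Proof.
suff [] : (exists r, Q n = 'X^(odd n) * (r \Po 'X^2)) /\
          (exists r, Q n.+1 = 'X^(odd n.+1) * (r \Po 'X^2)) by [].
elim: n => [|n [[r0 e0] [r1 e1]]].
  by rewrite orthopoly0 orthopoly1; split; exists 1; rewrite rmorph1 mulr1 ?expr0 ?expr1.
split; first by exists r1.
rewrite orthopolySS e0 e1/= negbK; case: (odd n) => /=.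
  exists (r1 - c n *: r0); rewrite comp_polyB comp_polyZ expr1 expr0 mul1r mulrBr.
  by rewrite -scalerAr.
exists ('X * r1 - c n *: r0); rewrite comp_polyB comp_polyZ rmorphM/= comp_polyX.
by rewrite expr1 expr0 !mul1r mulrA expr2.
Qed.

(** The functional kills odd polynomials; this is the zero diagonal of P. *)
Lemma momf_mulX_orthopoly_sqr n : momf s ('X * Q n * Q n) = 0.
Proof.
have [r ->] := orthopoly_parity n.
case: (odd n); rewrite ?expr0 ?expr1.
  have -> : 'X * ('X * (r \Po 'X^2)) * ('X * (r \Po 'X^2)) =
    'X * (('X * r * r) \Po 'X^2) by rewrite !rmorphM/= comp_polyX; ring.
  exact: momf_symmetrized_odd.
have -> : 'X * (1 * (r \Po 'X^2)) * (1 * (r \Po 'X^2)) = 'X * ((r * r) \Po 'X^2).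
  by rewrite !rmorphM/=; ring.
exact: momf_symmetrized_odd.
Qed.

Lemma orthopoly_norm_ge0 n : 0 <= h n.
Proof. exact: symmetrized_psd. Qed.

Lemma orthopoly_null n r : h n = 0 -> momf s (Q n * r) = 0.
Proof.
move=> hn; apply/eqP; rewrite -sqrf_eq0 eq_le sqr_ge0 andbT.
have := momf_CauchySchwarz (Q n) r (symmetrized_psd g_stieltjes).
by rewrite -/(h n) hn mul0r.
Qed.

(** Induction along the recurrence for Q (n + 2) against Q l: l = n + 1 follows from parity, l = n
    from the choice of [c n] or the nullity of Q n, and for l < n the factor X moves onto Q l. *)
Lemma orthopoly_orthogonal i j : i != j -> momf s (Q i * Q j) = 0.
Proof.
suff H n k l : (k <= n)%N -> (l < k)%N -> momf s (Q k * Q l) = 0.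
  by rewrite neq_ltn => /orP[] ij; [rewrite mulrC|]; apply: (H _ _ _ (leqnn _)).
elim: n k l => [|n ih] k l; first by rewrite leqn0 => /eqP->.
rewrite leq_eqVlt => /predU1P[->{k} ln|]; last by rewrite ltnS => /ih; apply.
case: n ih ln => [|n] ih ln.
  move: ln; rewrite ltnS leqn0 => /eqP ->.
  by have := momf_mulX_orthopoly_sqr 0; rewrite orthopoly0 orthopoly1 !mulr1.
have ort k m : (k <= n.+1)%N -> (m <= n.+1)%N -> k != m -> momf s (Q k * Q m) = 0.
  by move=> kn mn; rewrite neq_ltn => /orP[] km; [rewrite mulrC|]; apply: ih.
rewrite orthopolySS mulrBl -scalerAl momfB momfZ.
have [->|ln1] := eqVneq l n.+1.
  rewrite momf_mulX_orthopoly_sqr (ort n n.+1) ?mulr0 ?subr0//; lia.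
have [->|ln0] := eqVneq l n.
  have E : momf s ('X * Q n.+1 * Q n) = h n.+1.
    rewrite -mulrA mulrCA mulX_orthopoly mulrDr momfD -expr2 -/(h n.+1).
    case: n {ih ln ln1} ort => [|n] ort; first by rewrite mulr0 momf0 addr0.
    by rewrite -scalerAr momfZ (ort n.+2 n) ?mulr0 ?addr0//; lia.
  rewrite E -expr2 -/(h n) /c; have [hn|hn] := eqVneq (h n) 0.
    rewrite -E (_ : 'X * Q n.+1 * Q n = Q n * ('X * Q n.+1)); last exact: mulrC.
    by rewrite orthopoly_null// hn mulr0 subr0.
  by rewrite divfK// subrr.
rewrite (ort n l); [|lia..].
rewrite mulr0 subr0 -mulrA mulrCA mulX_orthopoly mulrDr momfD (ort n.+1 l.+1); [|lia..].
case: l ln ln1 ln0 => [|l] ln ln1 ln0; first by rewrite mulr0 momf0 addr0.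
by rewrite -scalerAr momfZ (ort n.+1 l) ?mulr0 ?add0r//; lia.
Qed.

(** One factor Q (n + 1) is expanded as X Q n minus a multiple of Q (n - 1): nullity of Q n kills
    the first term, orthogonality the second. *)
Lemma orthopoly_norm_succ_eq0 n : h n = 0 -> h n.+1 = 0.
Proof.
move=> hn; rewrite /h expr2 -[X in momf _ (X * _)](addrK (if n is m.+1 then c m *: Q m else 0)).
rewrite -mulX_orthopoly mulrBl momfB [_ * Q n]mulrC -mulrA orthopoly_null// sub0r.
case: n {hn} => [|n]; first by rewrite mul0r momf0 oppr0.
by rewrite -scalerAl momfZ orthopoly_orthogonal ?mulr0 ?oppr0// ltn_eqF// ltnW.
Qed.

(** Pythagoras in X Q n = Q (n + 1) + c Q (n - 1), then boundedness of multiplication by X. *)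
Lemma orthopoly_norm_succ_le (B : R) n : 0 <= B -> (forall n, g n <= B ^+ n) ->
  h n.+1 <= B * h n.
Proof.
move=> B0 gB; apply: le_trans (momf_symmetrized_mulX_le g_stieltjes (Q n) B0 gB).
rewrite mulX_orthopoly; case: n => [|n]; first by rewrite addr0.
rewrite sqrrD -scalerAr !momfD momfZ.
rewrite (@orthopoly_orthogonal n.+2 n); last by rewrite gtn_eqF// ltnW.
rewrite mulr0 !addr0 lerDl.
exact: (symmetrized_psd g_stieltjes).
Qed.

(** Off-diagonal entries of P in the orthonormal basis Q n / sqrt (h n). *)
Definition jacobi_weight n := Num.sqrt (h n.+1 / h n).
(** Coefficient of X^k on the normalised Q n, that is coordinate n of P^k e_0; a null Q n yields
    0. *)
Definition jacobi_power k n := (Num.sqrt (h n))^-1 * momf s ('X^k * Q n).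

Lemma jacobi_weight_ge0 n : 0 <= jacobi_weight n.
Proof. exact: sqrtr_ge0. Qed.

Lemma jacobi_weight_sqr_le (B : R) n : 0 <= B -> (forall n, g n <= B ^+ n) ->
  jacobi_weight n ^+ 2 <= B.
Proof.
move=> B0 gB; rewrite sqr_sqrtr ?divr_ge0 ?orthopoly_norm_ge0//.
have [->|hn] := eqVneq (h n) 0; first by rewrite invr0 mulr0.
rewrite ler_pdivrMr ?orthopoly_norm_succ_le//.
by rewrite lt_neqAle eq_sym hn orthopoly_norm_ge0.
Qed.

Lemma orthopoly_norm0 : h 0 = 1.
Proof. by rewrite /h orthopoly0 expr1n -(expr0 'X) momfXn. Qed.

Lemma jacobi_power0 n : jacobi_power 0 n = (n == 0%N)%:R.
Proof.
rewrite /jacobi_power mul1r; case: n => [|n].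
  rewrite orthopoly_norm0 sqrtr1 invr1 mul1r orthopoly0.
  by rewrite -orthopoly_norm0 /h orthopoly0 expr1n.
by rewrite -[Q n.+1]mulr1 -orthopoly0 orthopoly_orthogonal// mulr0.
Qed.

Lemma jacobi_power_0 k : jacobi_power k 0 = s k.
Proof. by rewrite /jacobi_power orthopoly_norm0 sqrtr1 invr1 mul1r orthopoly0 mulr1 momfXn. Qed.

Lemma jacobi_weight_mul k n : (Num.sqrt (h n))^-1 * momf s ('X^k * Q n.+1) =
  jacobi_weight n * jacobi_power k n.+1.
Proof.
rewrite /jacobi_weight /jacobi_power mulrA.
have [h1|h1] := eqVneq (h n.+1) 0.
  by rewrite [_ * Q _]mulrC orthopoly_null// !mulr0.
rewrite sqrtrM ?orthopoly_norm_ge0// sqrtrV ?orthopoly_norm_ge0//; congr (_ * _).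
by rewrite mulrAC divff ?mul1r// sqrtr_eq0 -ltNge lt_neqAle eq_sym h1 orthopoly_norm_ge0.
Qed.

Lemma jacobi_powerS0 k : jacobi_power k.+1 0 = jacobi_weight 0 * jacobi_power k 1.
Proof.
rewrite -jacobi_weight_mul {1}/jacobi_power.
by rewrite exprSr -mulrA mulX_orthopoly addr0.
Qed.

Lemma jacobi_powerSS k n : jacobi_power k.+1 n.+1 =
  jacobi_weight n * jacobi_power k n + jacobi_weight n.+1 * jacobi_power k n.+2.
Proof.
rewrite -jacobi_weight_mul {1}/jacobi_power exprSr -mulrA mulX_orthopoly.
rewrite mulrDr momfD -scalerAr momfZ mulrDr addrC; congr (_ + _).
rewrite /c /jacobi_weight /jacobi_power !mulrA; congr (_ * _).
rewrite sqrtrM ?orthopoly_norm_ge0// sqrtrV ?orthopoly_norm_ge0//.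
(* Both sides vanish as soon as h n or h (n + 1) is 0; in the first case h (n + 1) is 0 as well. *)
have [h0|h0] := eqVneq (h n) 0.
  by rewrite (orthopoly_norm_succ_eq0 h0) sqrtr0 mulr0 !mul0r.
have [h1|h1] := eqVneq (h n.+1) 0; first by rewrite h1 sqrtr0 mulr0 !mul0r.
have sq m : h m = Num.sqrt (h m) ^+ 2 by rewrite sqr_sqrtr ?orthopoly_norm_ge0.
have sqn m : h m != 0 -> Num.sqrt (h m) != 0.
  by move=> hm; rewrite sqrtr_eq0 -ltNge lt_neqAle eq_sym hm orthopoly_norm_ge0.
move: (sq n.+1) (sqn _ h1) (sq n) (sqn _ h0).
move: (Num.sqrt (h n.+1)) (Num.sqrt (h n)) => x1 x0 -> x1n0 -> x0n0.
by field; rewrite x0n0.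
Qed.

Lemma jacobi_power_norm k : \sum_(i < k.*2.+1) jacobi_power k i ^+ 2 = g k.
Proof.
rewrite (jacobi_power_parseval jacobi_power0 jacobi_powerS0 jacobi_powerSS jacobi_power_0).
by rewrite /s /symmetrized odd_double doubleK.
Qed.
End OrthogonalPolynomials.

(** * Weighted composition operators on l2 *)

Section WeightedComposition.
Context {R : realType}.
Implicit Types (w : R^nat) (sigma tau : nat -> nat) (M : R) (f g : l2 R).

(** Composing with sigma and multiplying by w scales |f k|^2 by the mass of w^2 on the fibre over k,
    so these masses govern boundedness and isometry; sigma is bijective for the shifts but not for
    the embedding V. *)
Definition fiber_mass w sigma n k := \sum_(0 <= j < n | sigma j == k) w j ^+ 2.

Definition fiber_mass_le w sigma M := forall n k, fiber_mass w sigma n k <= M ^+ 2.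

Definition wcomp_seq w sigma f (n : nat) : R[i] := (w n)%:C%C * f (sigma n).

Lemma sum_fiber_mass w sigma f n m :
  \sum_(0 <= k < m) fiber_mass w sigma n k * sqnormc (f k) =
  \sum_(0 <= j < n | (sigma j < m)%N) sqnormc (wcomp_seq w sigma f j).
Proof.
under eq_bigr do rewrite /fiber_mass mulr_suml big_mkcond.
rewrite exchange_big [RHS]big_mkcond; apply: eq_bigr => j _ /=.
rewrite (eq_bigr (fun k => if k == sigma j then w j ^+ 2 * sqnormc (f k) else 0)).
  by rewrite -big_mkcond big_nat1_eq/= /wcomp_seq sqnormcZ.
by move=> k _; rewrite eq_sym.
Qed.

Lemma wcomp_partial_le w sigma M f n : fiber_mass_le w sigma M ->
  \sum_(0 <= j < n) sqnormc (wcomp_seq w sigma f j) <= (`|M| * l2_rnorm f) ^+ 2.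
Proof.
move=> wM; pose m := (\max_(j < n) sigma j).+1.
have -> : \sum_(0 <= j < n) sqnormc (wcomp_seq w sigma f j) =
    \sum_(0 <= j < n | (sigma j < m)%N) sqnormc (wcomp_seq w sigma f j).
  rewrite !big_mkord; apply: eq_bigl => j.
  by rewrite /m ltnS; apply/esym; exact: (leq_bigmax (F := fun j : 'I_n => sigma j)).
rewrite -sum_fiber_mass exprMn real_normK ?num_real//.
apply: (@le_trans _ _ (M ^+ 2 * \sum_(0 <= k < m) sqnormc (f k))).
  by rewrite mulr_sumr; apply: ler_sum => k _; rewrite ler_wpM2r// ?sqnormc_ge0//; exact: wM.
by rewrite ler_wpM2l ?sqr_ge0// l2_partial_rnorm.
Qed.

Lemma wcomp_seq_ell2 w sigma M f : fiber_mass_le w sigma M ->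
  wcomp_seq w sigma f \in ell2 R.
Proof. by move=> wM; apply: ell2_bounded => n; exact: wcomp_partial_le wM. Qed.

Definition wcomp w sigma M (wM : fiber_mass_le w sigma M) f : l2 R :=
  L2 (wcomp_seq_ell2 f wM).

Lemma wcomp_linear w sigma M (wM : fiber_mass_le w sigma M) : linear (wcomp wM).
Proof.
move=> c f g; apply/val_inj/funext => n.
rewrite -[LHS]/((w n)%:C%C * (c * f (sigma n) + g (sigma n))).
by rewrite -[RHS]/(c * ((w n)%:C%C * f _) + (w n)%:C%C * g _) mulrDr mulrCA.
Qed.
HB.instance Definition _ w sigma M (wM : fiber_mass_le w sigma M) :=
  GRing.isLinear.Build R[i] (l2 R) (l2 R) _ (wcomp wM) (wcomp_linear wM).

Lemma wcomp_rnorm_le w sigma M (wM : fiber_mass_le w sigma M) f :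
  l2_rnorm (wcomp wM f) <= `|M| * l2_rnorm f.
Proof.
apply: l2_rnorm_le => [|n]; first by rewrite mulr_ge0 ?l2_rnorm_ge0.
exact: wcomp_partial_le wM.
Qed.

Lemma wcomp_bounded w sigma M (wM : fiber_mass_le w sigma M) :
  bounded_op (wcomp wM : {linear l2_hilbert R -> l2_hilbert R}).
Proof.
exists `|M| => f; change (`|wcomp wM f| <= `|M|%:C%C * `|f|).
by rewrite !l2_rnormE -rmorphM lecR; exact: wcomp_rnorm_le.
Qed.

Lemma fiber_mass_mono w sigma n n' k : (n <= n')%N ->
  fiber_mass w sigma n k <= fiber_mass w sigma n' k.
Proof.
move=> nn'; rewrite /fiber_mass [leRHS](big_cat_nat _ nn')//= lerDl.
by apply: sumr_ge0 => j _; exact: sqr_ge0.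
Qed.

(** Polarization: z = 1 gives d + d^* = 0 and z = i gives d = d^* for the discrepancy d. *)
Lemma isometry_inner (H K : hilbertType R) (V : {linear H -> K}) :
  (forall u, inner (V u) (V u) = inner u u) ->
  forall u v, inner (V u) (V v) = inner u v.
Proof.
move=> VV u v; apply/eqP; rewrite -subr_eq0; set d := _ - _.
have dD z : z * d + (z * d)^* = 0.
  have := VV (z *: u + v); rewrite linearD linearZ/= !dnormD !dnormZ !VV.
  move=> /addrI; rewrite !linearZl_LR/= => e.
  by rewrite /d mulrBr rmorphB/= addrACA -opprD e subrr.
have d1 : d + d^* = 0 by have := dD 1; rewrite mul1r.
have := dD 'i; rewrite rmorphM/= conjCi mulNr -mulrBr => /eqP.
rewrite mulf_eq0 (negbTE (neq0Ci _))/= subr_eq0 => /eqP d2.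
by move: d1; rewrite -d2 -mulr2n => /eqP; rewrite mulrn_eq0.
Qed.

(** By polarization norms suffice; each fibre reaches its full mass 1 at a finite stage, so every
    partial sum for f is dominated by one for its image. *)
Lemma wcomp_isometry w sigma (w1 : fiber_mass_le w sigma 1) :
  (forall k, exists n, 1 <= fiber_mass w sigma n k) ->
  forall f g, l2_inner (wcomp w1 f) (wcomp w1 g) = l2_inner f g.
Proof.
move=> ws.
apply: (@isometry_inner (l2_hilbert R) (l2_hilbert R) (wcomp w1)) => f.
change (l2_inner (wcomp w1 f) (wcomp w1 f) = l2_inner f f).
rewrite -!l2_normE !l2_rnormE; congr (_%:C%C ^+ 2); apply/eqP; rewrite eq_le.
apply/andP; split; first by have := wcomp_rnorm_le w1 f; rewrite normr1 mul1r.
apply: l2_rnorm_le => [|m]; first exact: l2_rnorm_ge0.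
have [n nP] : exists n, forall k, (k < m)%N -> 1 <= fiber_mass w sigma n k.
  elim: m => [|m [n nP]]; first by exists 0%N.
  have [n' n'P] := ws m; exists (maxn n n') => k.
  rewrite ltnS leq_eqVlt => /predU1P[->|/nP h].
    by apply: le_trans n'P _; rewrite fiber_mass_mono ?leq_maxr.
  by apply: le_trans h _; rewrite fiber_mass_mono ?leq_maxl.
apply: le_trans (l2_partial_rnorm (wcomp w1 f) n).
apply: (@le_trans _ _ (\sum_(0 <= k < m) fiber_mass w sigma n k * sqnormc (f k))).
  by apply: ler_sum_nat => k /nP h; rewrite ler_peMl ?sqnormc_ge0.
rewrite sum_fiber_mass big_mkcond; apply: ler_sum => j _.
by case: ifP => _; [exact: lexx|exact: sqnormc_ge0].
Qed.

Lemma fiber_mass_bij w sigma tau n k : cancel sigma tau -> cancel tau sigma ->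
  fiber_mass w sigma n k = if (tau k < n)%N then w (tau k) ^+ 2 else 0.
Proof.
move=> st ts; rewrite /fiber_mass (eq_bigl (fun j => j == tau k)).
  by rewrite big_nat1_eq.
by move=> j; rewrite (can2_eq st ts).
Qed.

Lemma fiber_mass_le_bij w sigma tau M : cancel sigma tau -> cancel tau sigma ->
  (forall n, `|w n| <= M) -> fiber_mass_le w sigma M.
Proof.
move=> st ts wM n k; rewrite (fiber_mass_bij _ _ _ st ts).
case: ifP => _; last exact: sqr_ge0.
rewrite -(real_normK (num_real (w _))) (@ler_pXn2r _ 2)// nnegrE.
exact: le_trans (wM 0%N).
Qed.

(** The operator is a real diagonal one followed by a unitary composition; the unitary crosses the
    inner product by isometry, the diagonal one coordinatewise. *)
Lemma wcomp_adjoint w w' sigma tau M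
    (wM : fiber_mass_le w sigma M) (wM' : fiber_mass_le w' tau M) :
  cancel sigma tau -> cancel tau sigma -> (forall n, `|w n| <= M) ->
  (forall n, w' n = w (tau n)) ->
  forall f g, l2_inner (wcomp wM f) g = l2_inner f (wcomp wM' g).
Proof.
move=> st ts wb w'E f g.
have one (n : nat) : `|(fun=> 1 : R) n| <= 1 by rewrite normr1.
have Us := @fiber_mass_le_bij (fun=> 1) _ _ _ st ts one.
have Ut := @fiber_mass_le_bij (fun=> 1) _ _ _ ts st one.
have wtb n : `|w' n| <= M by rewrite w'E.
have D := @fiber_mass_le_bij w' id id M (fun=> erefl) (fun=> erefl) wtb.
have -> : wcomp wM f = wcomp Us (wcomp D f).
  apply/val_inj/funext => n; rewrite -[LHS]/((w n)%:C%C * f (sigma n)).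
  by rewrite -[RHS]/(1 * ((w' (sigma n))%:C%C * f (sigma n))) mul1r w'E st.
have {1}-> : g = wcomp Us (wcomp Ut g).
  apply/val_inj/funext => n.
  by rewrite -[RHS]/(1 * (1 * g (tau (sigma n)))) !mul1r st.
rewrite wcomp_isometry; last first.
  move=> k; exists (tau k).+1.
  by rewrite (fiber_mass_bij _ _ _ st ts) ltnSn expr1n.
have E n : wcomp D f n * (wcomp Ut g n)^* = f n * (wcomp wM' g n)^*.
  rewrite -[wcomp D f n]/((w' n)%:C%C * f n) -[wcomp Ut g n]/(1 * g (tau n)) mul1r.
  rewrite -[wcomp wM' g n]/((w' n)%:C%C * g (tau n)) rmorphM/= mulrCA mulrA.
  by congr (_ * _ * _); apply/esym/CrealP; rewrite complex_real.
by rewrite /l2_inner; under eq_fun do rewrite E; under [in X in (_ +i* X)%C]eq_fun do rewrite E.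
Qed.
End WeightedComposition.

(** * Normal extension *)

Lemma int2_nat_bijection : exists (enc : int * int -> nat) (dec : nat -> int * int),
  cancel enc dec /\ cancel dec enc.
Proof.
have /card_set_bijP[enc] : ([set: int * int] #= [set: nat])%card.
  apply: eq_card_nat; first exact: countableP.
  move=> fin; apply: infinite_nat.
  have -> : [set: nat] = (fun n : nat => (n%:Z, 0 : int)) @^-1` [set: int * int] by [].
  by apply: finite_preimage => // x y _ _ [].
by rewrite setTT_bijective => -[dec K1 K2]; exists enc, dec.
Qed.

Section NormalExtension.
Context {R : realType}.
Variables (a b : R^nat) (p : nat -> nat -> R) (M : R).
Hypothesis b_gt0 : forall n, 0 < b n.
Hypothesis b_bounded : bounded_fun b.
Hypothesis aM : forall n, `|a n| <= M.
Hypothesis p_eq0 : forall k n, (k < n)%N -> p k n = 0.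
Hypothesis pS0 : forall k, p k.+1 0%N = a 0%N * p k 1%N.
Hypothesis pSS : forall k n, p k.+1 n.+1 = a n * p k n + a n.+1 * p k n.+2.
Hypothesis p_norm : forall k, \sum_(i < k.*2.+1) p k i ^+ 2 = moment b k.

Variables (enc : int * int -> nat) (dec : nat -> int * int).
Hypotheses (encK : cancel enc dec) (decK : cancel dec enc).

(** Extension by 0 makes Z x Z the index set, on which translations are bijective; as the weight at
    -1 is 0, P is merely replaced by its direct sum with 0. *)
Definition weightz (n : int) : R := if n is Posz m then a m else 0.

(** Coordinates of the vectors e_k (x) P^k e_0 / sqrt gamma_k. *)
Definition coefz (x : int * int) : R :=
  if x is (Posz k, Posz n) then p k n / Num.sqrt (moment b k) else 0.

(** P maps P^k e_0 / sqrt gamma_k to b k times the next such vector, since gamma_(k+1) = gamma_k (b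
    k)^2. *)
Lemma coefz_rec (k : nat) (n : int) : coefz (k.+1%:Z, n) * b k =
  weightz (n - 1) * coefz (k%:Z, n - 1) + weightz n * coefz (k%:Z, n + 1).
Proof.
have mk : 0 < moment b k by exact: moment_gt0.
have bk := b_gt0 k.
have sm : Num.sqrt (moment b k.+1) = Num.sqrt (moment b k) * b k.
  rewrite {1}/moment big_ord_recr/= sqrtrM ?(ltW mk)// sqrtr_sqr gtr0_norm//.
have m0 : Num.sqrt (moment b k) != 0 by rewrite sqrtr_eq0 -ltNge.
case: n => [[|n]|n].
- rewrite /= pS0 sm mul0r add0r; field.
  by rewrite m0 gt_eqF.
- rewrite (_ : n.+1%:Z - 1 = n%:Z); last by lia.
  rewrite (_ : n.+1%:Z + 1 = n.+2%:Z); last by lia.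
  by rewrite /= pSS sm; field; rewrite m0 gt_eqF.
- rewrite (_ : Negz n - 1 = Negz n.+1); last by lia.
  by rewrite /= !mul0r addr0.
Qed.

(** Each translation pairs the bilateral shift with one off-diagonal of P; [t1] and [t2] are the
    inverses of [s1] and [s2]. *)
Let s1 j := enc ((dec j).1 - 1, (dec j).2 - 1).
Let t1 j := enc ((dec j).1 + 1, (dec j).2 + 1).
Let s2 j := enc ((dec j).1 - 1, (dec j).2 + 1).
Let t2 j := enc ((dec j).1 + 1, (dec j).2 - 1).

Let s1K : cancel s1 t1.
Proof. by move=> j; rewrite /s1 /t1 encK/= !subrK -surjective_pairing. Qed.
Let t1K : cancel t1 s1.
Proof. by move=> j; rewrite /s1 /t1 encK/= !addrK -surjective_pairing. Qed.
Let s2K : cancel s2 t2.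
Proof. by move=> j; rewrite /s2 /t2 encK/= subrK addrK -surjective_pairing. Qed.
Let t2K : cancel t2 s2.
Proof. by move=> j; rewrite /s2 /t2 encK/= subrK addrK -surjective_pairing. Qed.

Let up j := weightz (dec j).2.
Let down j := weightz ((dec j).2 - 1).

Lemma weightz_le n : `|weightz n| <= M.
Proof.
case: n => [n|n]; first exact: aM.
by rewrite /= normr0; exact: le_trans (aM 0%N).
Qed.

Let H1 : fiber_mass_le down s1 M.
Proof. by apply: (fiber_mass_le_bij s1K t1K) => n; exact: weightz_le. Qed.
Let H2 : fiber_mass_le up s2 M.
Proof. by apply: (fiber_mass_le_bij s2K t2K) => n; exact: weightz_le. Qed.
Let H1' : fiber_mass_le up t1 M.
Proof. by apply: (fiber_mass_le_bij t1K s1K) => n; exact: weightz_le. Qed.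
Let H2' : fiber_mass_le down t2 M.
Proof. by apply: (fiber_mass_le_bij t2K s2K) => n; exact: weightz_le. Qed.

Definition jacobi_shift : {linear l2_hilbert R -> l2_hilbert R} :=
  wcomp H1 \+ wcomp H2.
Definition jacobi_shift_adj : {linear l2_hilbert R -> l2_hilbert R} :=
  wcomp H1' \+ wcomp H2'.

Lemma jacobi_shiftE u j : l2_val (jacobi_shift u) j =
  (down j)%:C%C * l2_val u (s1 j) + (up j)%:C%C * l2_val u (s2 j).
Proof. by []. Qed.

Lemma jacobi_shift_adjE u j : l2_val (jacobi_shift_adj u) j =
  (up j)%:C%C * l2_val u (t1 j) + (down j)%:C%C * l2_val u (t2 j).
Proof. by []. Qed.

Lemma jacobi_shift_normal : normal_op jacobi_shift.
Proof.
split.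
  have [M1 h1] := wcomp_bounded H1; have [M2 h2] := wcomp_bounded H2.
  exists (M1 + M2) => u; apply: le_trans (ler_normD _ _) _.
  by rewrite rmorphD mulrDl lerD.
exists jacobi_shift_adj; split=> [u v|u].
  change (l2_inner (wcomp H1 u + wcomp H2 u) v =
    l2_inner u (wcomp H1' v + wcomp H2' v)).
  rewrite linearDl linearDr; congr (_ + _).
    apply: (wcomp_adjoint _ _ s1K t1K) => n; first exact: weightz_le.
    by rewrite /up /down /t1 encK/= addrK.
  apply: (wcomp_adjoint _ _ s2K t2K) => n; first exact: weightz_le.
  by rewrite /up /down /t2 encK/=.
(* Both products are the identity tensor P^2, the bilateral shift being unitary. *)
suff E : l2_val (jacobi_shift (jacobi_shift_adj u)) =
    l2_val (jacobi_shift_adj (jacobi_shift u)) by exact: val_inj E.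
apply/funext => j.
rewrite !(jacobi_shiftE, jacobi_shift_adjE) /up /down /s1 /s2 /t1 /t2 !encK/=.
rewrite !(addrK, subrK).
ring.
Qed.

(** Weight and index map of the embedding V; the absolute value merges k and -k, but [coefz]
    vanishes at negative k. *)
Let vw j := coefz (dec j).
Let vs j := `|(dec j).1|%N.

Lemma fiber_mass_coefz n k : fiber_mass vw vs n k =
  \sum_(0 <= i < k.*2.+1 | (enc (k%:Z, i%:Z) < n)%N) coefz (k%:Z, i%:Z) ^+ 2.
Proof.
rewrite /fiber_mass big_mkcond/=.
transitivity (\sum_(0 <= j < n) \sum_(0 <= i < k.*2.+1)
    if j == enc (k%:Z, i%:Z) then coefz (k%:Z, i%:Z) ^+ 2 else 0).
  apply: eq_bigr => j _; rewrite /vs /vw -{3}(decK j).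
  case: (dec j) => x y /=; under eq_bigr do rewrite (can_eq encK) xpair_eqE.
  case: x => [k'|k'] /=; last first.
    by rewrite expr0n/= if_same big1.
  case: y => [i'|i'] /=; last first.
    by rewrite expr0n/= if_same big1// => i _; rewrite andbF.
  under eq_bigr do rewrite !eqz_nat.
  have [->|kk] /= := eqVneq k' k; last by rewrite big1.
  rewrite (eq_bigr (fun i => if i == i' then (p k i / Num.sqrt (moment b k)) ^+ 2 else 0)).
    rewrite -big_mkcond big_nat1_eq/=; case: ltnP => // ii.
    by rewrite p_eq0 ?mul0r ?expr0n// (leq_trans _ ii)// ltnS -addnn leq_addr.
  by move=> i _; rewrite eq_sym.
rewrite exchange_big [RHS]big_mkcond; apply: eq_bigr => i _ /=.
by rewrite -big_mkcond big_nat1_eq.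
Qed.

Lemma sum_coefz_sqr k : \sum_(0 <= i < k.*2.+1) coefz (k%:Z, i%:Z) ^+ 2 = 1.
Proof.
have mk : 0 < moment b k by exact: moment_gt0.
rewrite big_mkord /= (eq_bigr (fun i : 'I__ => p k i ^+ 2 / moment b k)).
  by rewrite -mulr_suml p_norm divff// gt_eqF.
by move=> i _; rewrite expr_div_n sqr_sqrtr ?ltW.
Qed.

Let HV : fiber_mass_le vw vs 1.
Proof.
move=> n k; rewrite fiber_mass_coefz expr1n -(sum_coefz_sqr k) big_mkcond.
by apply: ler_sum => i _; case: ifP => // _; rewrite sqr_ge0.
Qed.

Lemma fiber_mass_coefz_ge1 k : exists n, 1 <= fiber_mass vw vs n k.
Proof.
exists (\max_(i < k.*2.+1) enc (k%:Z, i%:Z)).+1.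
rewrite fiber_mass_coefz -(sum_coefz_sqr k) !big_mkord [leRHS](eq_bigl xpredT)//.
by move=> i; rewrite ltnS (leq_bigmax (F := fun i : 'I__ => enc (k%:Z, i%:Z))).
Qed.

Lemma jacobi_shift_subnormal : subnormal_shift b.
Proof.
exists (l2_hilbert R), jacobi_shift, (wcomp HV); split.
- exact: jacobi_shift_normal.
- exact: (wcomp_isometry HV fiber_mass_coefz_ge1).
move=> u; apply/val_inj/funext => j.
rewrite [RHS]jacobi_shiftE.
rewrite -[LHS]/((vw j)%:C%C * l2_val (wshift b u) (vs j)) wshiftE//.
rewrite -[l2_val _ (s1 j)]/((vw (s1 j))%:C%C * l2_val u (vs (s1 j))).
rewrite -[l2_val _ (s2 j)]/((vw (s2 j))%:C%C * l2_val u (vs (s2 j))).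
rewrite /vw /vs /s1 /s2 /up /down !encK; case: (dec j) => k n /=.
(* At k = 0 the shifted sequence is 0 and the right side reads [coefz] at first coordinate -1; at
   negative k every value of [coefz] involved is 0. *)
case: k => [[|k]|k].
- by rewrite /= !mul0r !mulr0 addr0.
- rewrite (_ : k.+1%:Z - 1 = k%:Z); last by lia.
  by rewrite [shift_seq _ _ _]/= !mulrA -mulrDl -!rmorphM -rmorphD coefz_rec.
- rewrite (_ : Negz k - 1 = Negz k.+1); last by lia.
  by rewrite /= !mul0r !mulr0 addr0.
Qed.
End NormalExtension.

(** * Subnormal shifts and Stieltjes moment sequences *)

Section Characterization.
Context {R : realType}.
Implicit Types (a b d : R^nat).

Lemma subnormal_shift_of_stieltjes b : bounded_fun b -> (forall n, 0 < b n) ->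
  stieltjes (moment b) -> subnormal_shift b.
Proof.
move=> bb b0 st; have /Defs.bounded_funP[M bM] := bb.
have M0 : 0 <= M := le_trans (normr_ge0 _) (bM 0%N).
have m0 : moment b 0 = 1 by rewrite /moment big_ord0.
(* The growth rate M^2 of the moments bounds the entries of P by M. *)
have mM n : moment b n <= (M ^+ 2) ^+ n.
  rewrite /moment -[X in _ ^+ X]card_ord -prodr_const; apply: ler_prod => i _.
  rewrite sqr_ge0/= -(real_normK (num_real (b i))) (@ler_pXn2r _ 2)// nnegrE.
have aM n : `|jacobi_weight (moment b) n| <= M.
  rewrite ger0_norm ?jacobi_weight_ge0//.
  rewrite -(@ler_pXn2r _ 2)// ?nnegrE ?jacobi_weight_ge0//.
  by apply: jacobi_weight_sqr_le => //; rewrite sqr_ge0.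
have [enc [dec [encK decK]]] := int2_nat_bijection.
have p0 := jacobi_power0 st m0.
have pS0 := jacobi_powerS0 st.
have pSS := jacobi_powerSS st.
have p_norm := jacobi_power_norm st m0.
have p_eq0 := jacobi_power_eq0 p0 pSS.
exact: (jacobi_shift_subnormal b0 bb aM p_eq0 pS0 pSS p_norm encK decK).
Qed.

(** Serves the moment sequence 1, 0, 0, ...; the zero operator is its own normal extension. *)
Lemma subnormal_shift0 b : (forall n, b n = 0) -> subnormal_shift b.
Proof.
move=> b0; have bb : bounded_fun b.
  by apply/Defs.bounded_funP; exists 0 => n; rewrite b0 normr0.
have T0 (u : l2 R) : wshift b u = 0.
  apply/val_inj/funext => n; rewrite -[LHS]/(wshift b u n) wshiftE//.
  by case: n => [//|n]; rewrite /= b0 mul0r.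
exists (l2_hilbert R), (wshift b), idfun; split => //; split; first exact: wshift_bounded.
exists (fun=> 0); split=> [u v|u]; last by rewrite linear0.
by change (l2_inner (wshift b u) v = l2_inner u 0); rewrite T0 linear0l linear0r.
Qed.

(** The ratio bound with B = 1, applied to the tail from n. *)
Lemma stieltjes_bounded_decreasing d (C : R) n : stieltjes d ->
  (forall n, d n <= C) -> d n.+1 <= d n.
Proof.
move=> st dC.
have := @logconvex_ratio_le _ (fun k => d (n + k)%N) 1 C ler01.
rewrite addn0 addn1 mul1r; apply => k; first exact: stieltjes_ge0.
  by rewrite !addnS; exact: stieltjes_logconvex.
by rewrite expr1n mulr1.
Qed.

(** delta n is the increment of ln (a n ^ 2); its nonnegativity makes the weights nondecreasing, so
    these logarithms stay between their value at 0 and ln (M ^ 2). *)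
Lemma log_moment_ratio_bounded a : (forall n, 0 < a n) -> bounded_fun a ->
  (forall n, 0 <= log_moment_ratio a n) ->
  exists C, forall n, log_moment_ratio a n <= C.
Proof.
move=> a0 /Defs.bounded_funP[M aM] d0.
pose l n := ln (a n ^+ 2).
have lE n : ln (moment a n.+1) = ln (moment a n) + l n.
  by rewrite {1}/moment big_ord_recr/= lnM ?posrE ?exprn_gt0// moment_gt0.
have dE n : log_moment_ratio a n = l n.+1 - l n.
  by rewrite log_moment_ratioE// !lE; ring.
have l0 n : l 0%N <= l n.
  elim: n => [//|n ih]; apply: le_trans ih _.
  by rewrite -subr_ge0 -dE.
exists (ln (M ^+ 2) - l 0%N) => n; rewrite dE lerB//.
have aM' : a n.+1 <= M by apply: le_trans (ler_norm _) (aM _).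
have M0 : 0 < M := lt_le_trans (a0 n.+1) aM'.
by rewrite ler_ln ?posrE ?exprn_gt0// (@ler_pXn2r _ 2)// nnegrE ltW.
Qed.

(* The weights below are 0 / 0 = 0 after the first vanishing moment. *)
Lemma shift_with_stieltjes_moments d (C : R) : stieltjes d -> 0 < d 0%N ->
  (forall n, d n <= C) -> shift_with_moments_subnormal (fun n => d n / d 0%N).
Proof.
move=> st d0 dC.
have dn n : 0 <= d n by exact: stieltjes_ge0.
have dec n : d n.+1 <= d n by exact: stieltjes_bounded_decreasing dC.
pose b n := Num.sqrt (d n.+1 / d n).
have b0 n : 0 <= b n by exact: sqrtr_ge0.
have bE n : b n ^+ 2 = d n.+1 / d n by rewrite sqr_sqrtr// divr_ge0.
have bb : bounded_fun b.
  apply/Defs.bounded_funP; exists 1 => n; rewrite ger0_norm//.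
  rewrite -(@ler_pXn2r _ 2)// ?nnegrE// expr1n bE.
  have [->|e] := eqVneq (d n) 0; first by rewrite invr0 mulr0.
  by rewrite ler_pdivrMr ?mul1r// lt_neqAle eq_sym e dn.
have mE n : moment b n = d n / d 0%N.
  elim: n => [|n ih]; first by rewrite /moment big_ord0 divff// gt_eqF.
  rewrite /moment big_ord_recr/= -/(moment b n) ih bE.
  have [e|e] := eqVneq (d n) 0.
    have -> : d n.+1 = 0 by apply: le_anti; rewrite dn -e dec.
    by rewrite !mul0r mulr0.
  by field; rewrite e gt_eqF.
exists b; split=> //.
have stb : stieltjes (moment b).
  rewrite (_ : moment b = (fun n => (d 0%N)^-1 * d n)).
    by apply: stieltjesZ => //; rewrite invr_ge0.
  by apply/funext => n; rewrite mE mulrC.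
have [d1|d1] := eqVneq (d 1%N) 0.
  apply: subnormal_shift0 => n.
  suff dn0 : d n.+1 = 0 by rewrite /b dn0 mul0r sqrtr0.
  by elim: n => [//|n ih]; apply: le_anti; rewrite dn -ih dec.
apply: subnormal_shift_of_stieltjes => // n.
(* Were d (k + 2) = 0, log-convexity would force d (k + 1) = 0; so positivity spreads from d 0 and d
   1. *)
have pos k : 0 < d k /\ 0 < d k.+1.
  elim: k => [|k [k0 k1]]; first by rewrite d0 lt_neqAle eq_sym d1 dn.
  split=> //; rewrite lt_neqAle dn andbT; apply/eqP => e.
  have := stieltjes_logconvex k st; rewrite -e mulr0.
  by rewrite leNgt exprn_gt0.
by rewrite sqrtr_gt0 divr_gt0//; have [] := pos n.
Qed.
End Characterization.

(* In (iii) the quotient requires delta 0 <> 0, and its sign has to be fixed: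
   delta n = - 2 ^- n occurs and gives a subnormal shift without (i) or (ii).
   The degenerate case delta = 0 (constant weights) is listed separately. *)
Theorem proposition1p4 (R : realType) (alpha : R^nat)
  (alpha_gt0 : forall n, 0 < alpha n) (alpha_bounded : bounded_fun alpha) :
  let delta := log_moment_ratio alpha in
  (moment_infinitely_divisible alpha <-> stieltjes delta) /\
  (stieltjes delta <->
     (forall n, delta n = 0) \/
     (0 < delta 0%N /\
      shift_with_moments_subnormal (fun n => delta n / delta 0%N))).
Proof.
move=> delta; split.
  rewrite (stieltjes_log_moment_ratio alpha_gt0); split=> h t t0.
    by apply: subnormal_shift_stieltjes; [exact: bounded_schur_pow|exact: h].
  apply: subnormal_shift_of_stieltjes; [exact: bounded_schur_pow| |exact: h].
  by move=> n; rewrite powR_gt0.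
split=> [st|[d0|[d0 [b [_ bb bm /(subnormal_shift_stieltjes bb) st]]]]].
- have [C dC] := log_moment_ratio_bounded alpha_gt0 alpha_bounded (stieltjes_ge0 st).
  have [d0|d0] := eqVneq (delta 0%N) 0; last first.
    have dp : 0 < delta 0%N by rewrite lt_neqAle eq_sym d0; exact: stieltjes_ge0.
    by right; split=> //; exact: shift_with_stieltjes_moments st dp dC.
  (* A nonnegative nonincreasing sequence that starts at 0 vanishes. *)
  left; elim=> [//|n ih]; apply: le_anti; rewrite (stieltjes_ge0 st) andbT -ih.
  exact: stieltjes_bounded_decreasing st dC.
- apply/stieltjesP => p.
  by rewrite /momf !big1 ?lexx// => i _; rewrite d0 mulr0.
- rewrite (_ : delta = (fun n => delta 0%N * moment b n)).
    by apply: stieltjesZ st; exact: ltW.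
  by apply/funext => n; rewrite bm mulrCA divff ?mulr1// gt_eqF.
Qed.
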